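(* Let $\mathcal R\in U_q[osp(m|n)]^-\otimes U_q[osp(m|n)]^+$ be the universal $R$-matrix of $U_q[osp(m|n)]$ and $\pi$ the vector representation. The $R$-matrix for the vector representation, $R=(\pi\otimes\pi)\mathcal R$, is given by $$R=\sum_{a,b\in\mathcal I}q^{(\varepsilon_a,\varepsilon_b)}E^a_a\otimes E^b_b+(q-q^{-1})\sum_{\varepsilon_b>\varepsilon_a}(-1)^{[b]}E^a_b\otimes\tilde\sigma_{ba},$$ where $$\tilde\sigma_{ba}=E^b_a-(-1)^{[b]([a]+[b])}\xi_a\xi_bq^{(\rho,\varepsilon_a-\varepsilon_b)}E^{\overline a}_{\overline b},\qquad\varepsilon_b>\varepsilon_a.$$
   Context: Throughout $m>2$ and $n=2k\ge2$ are integers, $l=\lfloor m/2\rfloor$, and $q$ is a nonzero complex number that is not a root of unity (with fixed choices of the powers $q^x$ used). Indices. $\mathcal I$ is the disjoint union of even indices $i\in\{1,\dots,m\}$ (grading $[i]=0$, Latin letters) and odd indices $\mu\in\{1,\dots,n\}$ (grading $[\mu]=1$, Greek letters). Writing $i=1$ or $\mu=k$ as a subscript specifies the even index $1$ or the odd index $k$. Put $\overline{i}=m+1-i$, $\overline{\mu}=n+1-\mu$, and $\xi_i=1$, $\xi_\mu=(-1)^\mu$. Weights. To $a\in\mathcal I$ is attached a weight $\varepsilon_a$ (also written $\delta_\mu$ if $a=\mu$ is odd) with $\varepsilon_{\overline a}=-\varepsilon_a$ (so $\varepsilon_{l+1}=0$ if $m=2l+1$); $\varepsilon_1,\dots,\varepsilon_l,\delta_1,\dots,\delta_k$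 are linearly independent, with bilinear form $(\varepsilon_i,\varepsilon_j)=\delta^i_j$, $(\delta_\mu,\delta_\nu)=-\delta^\mu_\nu$, $(\varepsilon_i,\delta_\mu)=0$ for $1\le i,j\le l$, $1\le\mu,\nu\le k$. Weights are totally ordered by $\delta_1>\dots>\delta_k>\varepsilon_1>\dots>\varepsilon_m>\delta_{k+1}>\dots>\delta_n$. The graded half-sum of positive roots is $\rho=\frac12\sum_{i=1}^l(m-2i)\varepsilon_i+\frac12\sum_{\mu=1}^k(n-m+2-2\mu)\delta_\mu$. Simple roots: $\alpha_i=\varepsilon_i-\varepsilon_{i+1}$ ($1\le i<l$); $\alpha_l=\varepsilon_l+\varepsilon_{l-1}$ if $m=2l$, $\alpha_l=\varepsilon_l$ if $m=2l+1$; $\alpha_\mu=\delta_\mu-\delta_{\mu+1}$ ($1\le\mu<k$); $\alpha_s=\delta_k-\varepsilon_1$ (the only odd simple root). $U_q[osp(m|n)]$ is the $\mathbb Z_2$-graded unital associative algebra generated by raising generators $e_c$, lowering generators $f_c$ (one pair for each simple root $\alpha_c$; $e_s,f_s$ odd, the rest even) and the Cartan subalgebra $H$, spanned by elements $h_\lambda$ linear in the weight $\lambda$, together with all $q^{h}$, $h\in H$; $h_c:=h_{\alpha_c}$. With graded commutator $[A,B]=AB-(-1)^{[A][B]}BA$, the relations are: $[h_\lambda,h_{\lambda'}]=0$, $[h_\lambda,e_c]=(\lambda,\alpha_c)e_c$, $[h_\lambda,f_c]=-(\lambda,\alpha_c)f_c$, $[e_c,f_d]=\delta^c_d\frac{q^{h_c}-q^{-h_c}}{q-q^{-1}}$,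 $[e_c,e_c]=[f_c,f_c]=0$ if $(\alpha_c,\alpha_c)=0$, and the standard and extra (higher order) $q$-Serre relations. In terms of $E_c=e_cq^{\frac12h_c}$ and $[E_c,x]_q=\mathrm{ad}E_c\circ x=E_cx-(-1)^{[E_c][x]}q^{(\alpha_c,\mathrm{wt}\,x)}xE_c$, the standard ones are $(\mathrm{ad}E_b\,\circ)^{1-a_{bc}}E_c=0$ for $b\ne c$ (where $a_{bc}=2(\alpha_b,\alpha_c)/(\alpha_b,\alpha_b)$ if $(\alpha_b,\alpha_b)\neq0$; and for $(\alpha_b,\alpha_b)=0$ the relation $\mathrm{ad}E_b\circ E_c=0$ when $(\alpha_b,\alpha_c)=0$), and similarly for $F_c=f_cq^{\frac12h_c}$; the extra ones are those of the standard presentation of the quantum superalgebra for this Dynkin diagram (Yamane, Publ. RIMS 35 (1999)), e.g. for $k\ge2$: $[E_s,[E_{\mu=k-1},[E_s,E_{i=1}]_q]_q]_q=0=[E_s,[E_{i=1},[E_s,E_{\mu=k-1}]_q]_q]_q$. Tensor products are graded: $(a\otimes b)(c\otimes d)=(-1)^{[b][c]}ac\otimes bd$. The coproduct is the algebra homomorphism with $\Delta(e_c)=q^{\frac12h_c}\otimes e_c+e_c\otimes q^{-\frac12h_c}$, $\Delta(f_c)=q^{\frac12h_c}\otimes f_c+f_c\otimes q^{-\frac12h_c}$, $\Delta(q^{h})=q^{h}\otimes q^{h}$. The graded twist is $T(a\otimes b)=(-1)^{[a][b]}b\otimes a$ and $\Delta^T=T\Delta$. $U_q[osp(m|n)]^+$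 (resp. $U_q[osp(m|n)]^-$) is the Hopf subsuperalgebra generated by the raising (resp. lowering) generators and Cartan elements. A universal $R$-matrix is an even invertible element $\mathcal R$ of (a suitable completion of) $U_q[osp(m|n)]^{\otimes2}$ with $\mathcal R\Delta(a)=\Delta^T(a)\mathcal R$ for all $a$, $(\mathrm{id}\otimes\Delta)\mathcal R=\mathcal R_{13}\mathcal R_{12}$, $(\Delta\otimes\mathrm{id})\mathcal R=\mathcal R_{13}\mathcal R_{23}$. There is a unique one in $U_q[osp(m|n)]^-\otimes U_q[osp(m|n)]^+$ (completed), arising from Drinfeld's double construction. Vector representation. $V$ is the $(m+n)$-dimensional graded space with homogeneous basis $|a\rangle$, $a\in\mathcal I$; $E^a_b|c\rangle=\delta^c_b|a\rangle$, and $E^a_b$ has grading $[a]+[b]$. Put $\Sigma^a_b=E^a_b-(-1)^{[a]([a]+[b])}\xi_a\xi_bE^{\overline b}_{\overline a}$. Then $\pi:U_q[osp(m|n)]\to\mathrm{End}\,V$ is given by $\pi(h_{\varepsilon_a})=(-1)^{[a]}\Sigma^a_a$; $\pi(e_i)=\Sigma^i_{i+1}$, $\pi(f_i)=\Sigma^{i+1}_i$ ($1\le i<l$); $\pi(e_l)=\Sigma^{l-1}_{\overline l}$, $\pi(f_l)=\Sigma^{\overline l}_{l-1}$ if $m=2l$; $\pi(e_l)=\Sigma^l_{l+1}$, $\pi(f_l)=\Sigma^{l+1}_l$ if $m=2l+1$; $\pi(e_\mu)=\Sigma^\mu_{\mu+1}$, $\pi(f_\mu)=-\Sigma^{\mu+1}_\mu$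 ($1\le\mu<k$); $\pi(e_s)=\Sigma^{\mu=k}_{i=1}$, $\pi(f_s)=-\Sigma^{i=1}_{\mu=k}$. *)

(* Defs.v *)
From HB Require Import structures.
From mathcomp Require Import all_boot all_order all_algebra.
From mathcomp Require Import reals.
From mathcomp.real_closed Require Import complex mxtens.

Set Implicit Arguments.
Unset Strict Implicit.
Unset Printing Implicit Defensive.

Import GRing.Theory.
Local Open Scope ring_scope.

(* A consistent choice of the powers q^x: a homomorphism from the additive
   group to the multiplicative one with q^1 = q (the values are then nonzero
   as soon as q is). *)
Definition power_choice (F : fieldType) (q : F) (qp : F -> F) : Prop :=
  (forall x y, qp (x + y) = qp x * qp y) /\ qp 1 = q.

Section IndicesAndWeights.
Variables (F : fieldType) (m k : nat).
Local Notation l := m./2.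
Local Notation n := k.*2.

(* Labels carry the 1-based numbers: [inl i] is the even index i,
   [inr mu] is the odd index mu. *)
Definition index_type : eqType := (nat + nat)%type.
Definition lat (i : nat) : index_type := inl i.
Definition grk (mu : nat) : index_type := inr mu.

Definition Iset : seq index_type :=
  [seq lat i | i <- iota 1 m] ++ [seq grk mu | mu <- iota 1 n].

Definition gr (a : index_type) : bool := if a is inr _ then true else false.

Definition bar (a : index_type) : index_type :=
  match a with inl i => lat (m.+1 - i)%N | inr mu => grk (n.+1 - mu)%N end.

Definition xi (a : index_type) : F :=
  match a with inl _ => 1 | inr mu => (-1) ^+ mu end.

(* Coordinates with respect to eps_1, .., eps_l, delta_1, .., delta_k. *)
Definition weight := 'rV[F]_(l + k).

(* The two terms cancel for the middle index l+1 when m = 2l+1. *)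
Definition eps (a : index_type) : weight :=
  match a with
  | inl i => row_mx (\row_(j < l) ((i == j.+1)%:R - (m.+1 - i == j.+1)%N%:R)) 0
  | inr mu => row_mx 0 (\row_(j < k) ((mu == j.+1)%:R - (n.+1 - mu == j.+1)%N%:R))
  end.

Definition wform (x y : weight) : F :=
  \sum_(i < l) x 0 (lshift k i) * y 0 (lshift k i)
  - \sum_(mu < k) x 0 (rshift l mu) * y 0 (rshift l mu).

(* Position in delta_1 > .. > delta_k > eps_1 > .. > eps_m > delta_(k+1)
   > .. > delta_n. *)
Definition position (a : index_type) : nat :=
  match a with
  | inl i => (k + i)%N
  | inr mu => if (mu <= k)%N then mu else (m + mu)%N
  end.

Definition eps_gt (b a : index_type) : bool := (position b < position a)%N.

Definition rho : weight :=
  2%:R^-1 *: row_mx (\row_(i < l) (m%:R - (2 * i.+1)%:R))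
                    (\row_(mu < k) (n%:R - m%:R + 2%:R - (2 * mu.+1)%:R)).

(* [Nlat i] is alpha_(i+1), [Ngrk mu] is alpha_(mu+1) (0-based ordinals), and
   [Nodd] is alpha_s. *)
Inductive node := Nlat of 'I_l | Ngrk of 'I_k.-1 | Nodd.

Definition alpha (c : node) : weight :=
  match c with
  | Nlat i =>
      if (i.+1 < l)%N then eps (lat i.+1) - eps (lat i.+2)
      else if odd m then eps (lat l) else eps (lat l) + eps (lat l.-1)
  | Ngrk mu => eps (grk mu.+1) - eps (grk mu.+2)
  | Nodd => eps (grk k) - eps (lat 1)
  end.

Definition npar (c : node) : bool := if c is Nodd then true else false.

End IndicesAndWeights.

Section QuantumSuperalgebra.
Variables (F : fieldType) (m k : nat) (q : F) (qp : F -> F).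
Local Notation l := m./2.
Local Notation n := k.*2.
Local Notation weight := (weight F m k).
Local Notation node := (node m k).
Local Notation alpha := (@alpha F m k).
Local Notation wform := (@wform F m k).

(* [Gh x] is h_x and [Gq x] is q^(h_x). *)
Inductive gen := Ge of node | Gf of node | Gh of weight | Gq of weight.

Definition gpar (g : gen) : bool :=
  match g with Ge c | Gf c => npar c | Gh _ | Gq _ => false end.

(* U_q[osp(m|n)] is presented by the generators [gen] and the relations [rel]:
   every element is represented by an expression, and a representation is an
   assignment of operators to the generators under which both sides of every
   relation have the same value. *)
Inductive expr :=
  | Gen of gen
  | One
  | Scale of F & expr
  | Add of expr & expr
  | Mul of expr & expr.

Definition Minus (x y : expr) : expr := Add x (Scale (-1) y).
Definition Zero : expr := Scale 0 One.

Definition gen_e (c : node) : expr := Gen (Ge c).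
Definition gen_f (c : node) : expr := Gen (Gf c).
Definition gen_h (x : weight) : expr := Gen (Gh x).
Definition gen_q (x : weight) : expr := Gen (Gq x).

(* Graded commutator of x and y, of parities px and py. *)
Definition gcomm (px py : bool) (x y : expr) : expr :=
  Minus (Mul x y) (Scale ((-1) ^+ (px && py)) (Mul y x)).

(* Homogeneous elements, with their parity and weight. *)
Record helt := Helt { hval : expr; hpar : bool; hwt : weight }.

(* E_c = e_c q^(h_c / 2) for [up = true], F_c = f_c q^(h_c / 2) otherwise. *)
Definition EF (up : bool) (c : node) : helt :=
  Helt (Mul (if up then gen_e c else gen_f c) (gen_q (2%:R^-1 *: alpha c)))
       (npar c) (if up then alpha c else - alpha c).

(* In both cases Delta(X) = q^(h_c) (x) X + X (x) 1 for X = E_c, F_c, so that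
   ad X o x = X x -/+ q^((alpha_c, wt x)) x X with the same exponent. *)
Definition qad (up : bool) (c : node) (x : helt) : helt :=
  let X := EF up c in
  Helt (Minus (Mul (hval X) (hval x))
            (Scale ((-1) ^+ (npar c && hpar x) * qp (wform (alpha c) (hwt x)))
                   (Mul (hval x) (hval X))))
       (npar c (+) hpar x) (hwt X + hwt x).

Inductive rel : expr -> expr -> Prop :=
  | rel_h_linear a x y : rel (gen_h (a *: x + y)) (Add (Scale a (gen_h x)) (gen_h y))
  | rel_q0 : rel (gen_q 0) One
  | rel_qD x y : rel (gen_q (x + y)) (Mul (gen_q x) (gen_q y))
  | rel_hh x y : rel (Mul (gen_h x) (gen_h y)) (Mul (gen_h y) (gen_h x))
  | rel_hq x y : rel (Mul (gen_h x) (gen_q y)) (Mul (gen_q y) (gen_h x))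
  | rel_he x c : rel (gcomm false (npar c) (gen_h x) (gen_e c))
                     (Scale (wform x (alpha c)) (gen_e c))
  | rel_hf x c : rel (gcomm false (npar c) (gen_h x) (gen_f c))
                     (Scale (- wform x (alpha c)) (gen_f c))
  | rel_qe x c : rel (Mul (gen_q x) (gen_e c))
                     (Scale (qp (wform x (alpha c))) (Mul (gen_e c) (gen_q x)))
  | rel_qf x c : rel (Mul (gen_q x) (gen_f c))
                     (Scale (qp (- wform x (alpha c))) (Mul (gen_f c) (gen_q x)))
  | rel_ef c : rel (gcomm (npar c) (npar c) (gen_e c) (gen_f c))
                   (Scale (q - q^-1)^-1 (Minus (gen_q (alpha c)) (gen_q (- alpha c))))
  | rel_ef0 c d : c <> d -> rel (gcomm (npar c) (npar d) (gen_e c) (gen_f d)) Zero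
  | rel_ee c : wform (alpha c) (alpha c) = 0 ->
      rel (gcomm (npar c) (npar c) (gen_e c) (gen_e c)) Zero
  | rel_ff c : wform (alpha c) (alpha c) = 0 ->
      rel (gcomm (npar c) (npar c) (gen_f c) (gen_f c)) Zero
  (* N = 1 - a_bc *)
  | rel_serre up b c (N : nat) : b <> c -> wform (alpha b) (alpha b) != 0 ->
      N%:R = 1 - 2%:R * wform (alpha b) (alpha c) / wform (alpha b) (alpha b) ->
      rel (hval (iter N (qad up b) (EF up c))) Zero
  | rel_serre0 up b c : b <> c -> wform (alpha b) (alpha b) = 0 ->
      wform (alpha b) (alpha c) = 0 ->
      rel (hval (qad up b (EF up c))) Zero
  (* Extra relations at the odd node, for its neighbour mu = k-1 (if k >= 2)
     and each even neighbour i: i = 1, and also i = 2 when m = 4.  The triple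
     s, i = 1, i = 2 for m = 4 is a D(2,1) subdiagram and has none. *)
  | rel_extra1 up mu i :
      wform (alpha (Nodd m k)) (alpha (Ngrk m mu)) != 0 ->
      wform (alpha (Nodd m k)) (alpha (Nlat k i)) != 0 ->
      rel (hval (qad up (Nodd m k) (qad up (Ngrk m mu)
                  (qad up (Nodd m k) (EF up (Nlat k i)))))) Zero
  | rel_extra2 up mu i :
      wform (alpha (Nodd m k)) (alpha (Ngrk m mu)) != 0 ->
      wform (alpha (Nodd m k)) (alpha (Nlat k i)) != 0 ->
      rel (hval (qad up (Nodd m k) (qad up (Nlat k i)
                  (qad up (Nodd m k) (EF up (Ngrk m mu)))))) Zero.

(* The subsuperalgebras generated by the raising, resp. lowering, generators
   and the Cartan elements. *)
Fixpoint in_Uplus (x : expr) : bool :=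
  match x with
  | Gen (Gf _) => false
  | Gen _ | One => true
  | Scale _ x1 => in_Uplus x1
  | Add x1 x2 | Mul x1 x2 => in_Uplus x1 && in_Uplus x2
  end.

Fixpoint in_Uminus (x : expr) : bool :=
  match x with
  | Gen (Ge _) => false
  | Gen _ | One => true
  | Scale _ x1 => in_Uminus x1
  | Add x1 x2 | Mul x1 x2 => in_Uminus x1 && in_Uminus x2
  end.

(* Elements of the algebraic tensor square: finite sums of pure tensors. *)
Definition tensor2 := seq (expr * expr).

Definition coprod (g : gen) : tensor2 :=
  match g with
  | Ge c => [:: (gen_q (2%:R^-1 *: alpha c), gen_e c);
                (gen_e c, gen_q (- (2%:R^-1 *: alpha c)))]
  | Gf c => [:: (gen_q (2%:R^-1 *: alpha c), gen_f c);
                (gen_f c, gen_q (- (2%:R^-1 *: alpha c)))]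
  | Gh x => [:: (gen_h x, One); (One, gen_h x)]
  | Gq x => [:: (gen_q x, gen_q x)]
  end.

(* Finite-dimensional superspaces with a homogeneous basis, matrices acting on
   columns.  The graded tensor product End V (x) End W is identified with
   End (V (x) W) by (a (x) b)(v (x) w) = (-1)^([b][v]) av (x) bw. *)
Definition gtens (d1 d2 : nat) (p1 : 'I_d1 -> bool) (p2 : 'I_d2 -> bool)
    (A : 'M[F]_d1) (B : 'M[F]_d2) : 'M[F]_(d1 * d2) :=
  \matrix_(x, y)
    let: (x1, x2) := mxtens_unindex x in let: (y1, y2) := mxtens_unindex y in
    (-1) ^+ ((p2 x2 (+) p2 y2) && p1 y1) * (A x1 y1 * B x2 y2).

(* T : End W (x) End V -> End V (x) End W, which under the identification
   above is conjugation by w (x) v |-> (-1)^([v][w]) v (x) w. *)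
Definition gtwist (d1 d2 : nat) (p1 : 'I_d1 -> bool) (p2 : 'I_d2 -> bool)
    (A : 'M[F]_(d2 * d1)) : 'M[F]_(d1 * d2) :=
  \matrix_(x, y)
    let: (x1, x2) := mxtens_unindex x in let: (y1, y2) := mxtens_unindex y in
    (-1) ^+ ((p1 x1 && p2 x2) (+) (p1 y1 && p2 y2))
    * A (mxtens_index (x2, x1)) (mxtens_index (y2, y1)).

(* Operators assigned to the generators, not yet required to satisfy [rel]. *)
Record premodule := Premodule {
  mdim : nat;
  mpar : 'I_mdim -> bool;
  mact : gen -> 'M[F]_mdim
}.

Fixpoint eval (V : premodule) (x : expr) : 'M[F]_(mdim V) :=
  match x with
  | Gen g => mact V g
  | One => 1%:M
  | Scale a x1 => a *: eval V x1
  | Add x1 x2 => eval V x1 + eval V x2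
  | Mul x1 x2 => eval V x1 *m eval V x2
  end.

Definition eval2 (V W : premodule) (t : tensor2) : 'M[F]_(mdim V * mdim W) :=
  \sum_(x <- t) gtens (@mpar V) (@mpar W) (eval V x.1) (eval W x.2).

(* The basis consists of weight vectors, of weights w. *)
Definition has_weights (V : premodule) (w : 'I_(mdim V) -> weight) : Prop :=
  forall x : weight,
    mact V (Gh x) = diag_mx (\row_i wform x (w i)) /\
    mact V (Gq x) = diag_mx (\row_i qp (wform x (w i))).

(* Finite-dimensional graded weight modules over U_q[osp(m|n)]. *)
Definition is_module (V : premodule) : Prop :=
  [/\ forall x y, rel x y -> eval V x = eval V y,
      forall g i j, mact V g i j != 0 -> mpar i (+) mpar j = gpar g
    & exists w, has_weights (V := V) w].

(* V (x) W, on which x acts by Delta(x). *)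
Definition tens (V W : premodule) : premodule :=
  {| mdim := mdim V * mdim W;
     mpar := fun i => mpar (mxtens_unindex i).1 (+) mpar (mxtens_unindex i).2;
     mact := fun g => eval2 V W (coprod g) |}.

(* The completion of U_q[osp(m|n)]^(x)2 is taken with respect to its actions
   on V (x) W for V, W finite-dimensional weight modules: an element is a
   family of operators [R V W] such that, for any finitely many pairs (V, W),
   some element of the algebraic tensor square acts as R on all of them.
   For the completion of U_q^- (x) U_q^+, that element is taken in
   U_q^- (x) U_q^+.  The values of R outside modules are irrelevant. *)
Definition family2 := forall V W : premodule, 'M[F]_(mdim V * mdim W).

Definition in_completion (P1 P2 : pred expr) (R : family2) : Prop :=
  forall (N : nat) (V W : 'I_N -> premodule),
    (forall i, is_module (V i)) -> (forall i, is_module (W i)) ->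
  exists2 t : tensor2,
    all (fun x => P1 x.1 && P2 x.2) t &
    forall i, R (V i) (W i) = eval2 (V i) (W i) t.

Definition in_completed_U2 : family2 -> Prop := in_completion predT predT.

Definition in_completed_Uminus_Uplus : family2 -> Prop :=
  in_completion in_Uminus in_Uplus.

(* A_12, A_13, A_23 acting on a triple tensor product whose basis is indexed
   through [un], with the signs of the graded tensor product. *)
Section Legs.
Variables (d1 d2 d3 d : nat) (un : 'I_d -> 'I_d1 * 'I_d2 * 'I_d3).
Variables (p1 : 'I_d1 -> bool) (p2 : 'I_d2 -> bool) (p3 : 'I_d3 -> bool).

Definition leg12 (A : 'M[F]_(d1 * d2)) : 'M[F]_d :=
  \matrix_(x, y)
    let: (x1, x2, x3) := un x in let: (y1, y2, y3) := un y in
    A (mxtens_index (x1, x2)) (mxtens_index (y1, y2)) * (x3 == y3)%:R.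

Definition leg13 (A : 'M[F]_(d1 * d3)) : 'M[F]_d :=
  \matrix_(x, y)
    let: (x1, x2, x3) := un x in let: (y1, y2, y3) := un y in
    (-1) ^+ ((p3 x3 (+) p3 y3) && p2 y2)
    * A (mxtens_index (x1, x3)) (mxtens_index (y1, y3)) * (x2 == y2)%:R.

Definition leg23 (A : 'M[F]_(d2 * d3)) : 'M[F]_d :=
  \matrix_(x, y)
    let: (x1, x2, x3) := un x in let: (y1, y2, y3) := un y in
    (-1) ^+ ((p2 x2 (+) p3 x3 (+) (p2 y2 (+) p3 y3)) && p1 y1)
    * A (mxtens_index (x2, x3)) (mxtens_index (y2, y3)) * (x1 == y1)%:R.

End Legs.

Definition unindexR (d1 d2 d3 : nat) (x : 'I_(d1 * (d2 * d3))) :=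
  let: (x1, x23) := mxtens_unindex x in
  let: (x2, x3) := mxtens_unindex x23 in (x1, x2, x3).

Definition unindexL (d1 d2 d3 : nat) (x : 'I_(d1 * d2 * d3)) :=
  let: (x12, x3) := mxtens_unindex x in
  let: (x1, x2) := mxtens_unindex x12 in (x1, x2, x3).

(* Equations in the completed tensor square or cube are equations between the
   operators by which the two sides act; (id (x) Delta) R acts on U, V, W as R
   acts on U and V (x) W. *)
Record universal_Rmatrix (R : family2) : Prop := {
  uR_completed : in_completed_U2 R;
  uR_even : forall V W, is_module V -> is_module W ->
    forall x y, R V W x y != 0 -> @mpar (tens V W) x = @mpar (tens V W) y;
  uR_invertible : exists2 R' : family2, in_completed_U2 R' &
    forall V W, is_module V -> is_module W ->
      R V W *m R' V W = 1%:M /\ R' V W *m R V W = 1%:M;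
  uR_intertwines : forall V W, is_module V -> is_module W -> forall a : expr,
    R V W *m eval (tens V W) a
    = gtwist (@mpar V) (@mpar W) (eval (tens W V) a) *m R V W;
  uR_id_Delta : forall U V W, is_module U -> is_module V -> is_module W ->
    R U (tens V W)
    = leg13 (@unindexR (mdim U) (mdim V) (mdim W)) (@mpar V) (@mpar W) (R U W)
      *m leg12 (@unindexR (mdim U) (mdim V) (mdim W)) (R U V);
  uR_Delta_id : forall U V W, is_module U -> is_module V -> is_module W ->
    R (tens U V) W
    = leg13 (@unindexL (mdim U) (mdim V) (mdim W)) (@mpar V) (@mpar W) (R U W)
      *m leg23 (@unindexL (mdim U) (mdim V) (mdim W))
               (@mpar U) (@mpar V) (@mpar W) (R V W)
}.

(* In Drinfeld's double the component of R in the completed U^0 (x) U^0, i.e.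
   its part preserving both weights, is q^t with t in H (x) H having rational
   coefficients.  (The axioms then force t = sum_i h_i (x) h^i.)  For complex q
   the other conditions alone do not always determine R: when 4 divides m, it
   can be multiplied by chi(x, y) on the vectors of weights x, y, where chi is
   a bicharacter of the weights modulo the root lattice with
   chi(eps_1, eps_1) = -1; this changes the sign of R on the vector
   representation. *)
Definition rational_Cartan_part (R : family2) : Prop :=
  exists t : 'M[rat]_(l + k),
  forall V W, is_module V -> is_module W ->
  forall wV wW, has_weights (V := V) wV -> has_weights (V := W) wW ->
  forall i j i' j', wV i = wV i' -> wW j = wW j' ->
    R V W (mxtens_index (i, j)) (mxtens_index (i', j'))
    = ((i == i') && (j == j'))%:R
      * qp ((wV i *m map_mx ratr t *m (wW j)^T) 0 0).

End QuantumSuperalgebra.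

Section VectorRepresentation.
Variables (F : fieldType) (m k : nat) (qp : F -> F).
Local Notation l := m./2.
Local Notation n := k.*2.
Local Notation xi := (@xi F).
Local Notation bar := (bar m k).

(* The basis vector number x is |label x>. *)
Definition label (x : 'I_(m + n)) : index_type := nth (lat 0) (Iset m k) x.

Definition vec_par (x : 'I_(m + n)) : bool := gr (label x).

Definition E (a b : index_type) : 'M[F]_(m + n) :=
  \matrix_(x, y) ((label x == a) && (label y == b))%:R.

Definition Sigma (a b : index_type) : 'M[F]_(m + n) :=
  E a b - ((-1) ^+ (gr a && (gr a (+) gr b)) * xi a * xi b) *: E (bar b) (bar a).

Definition vec_e (c : node m k) : 'M[F]_(m + n) :=
  match c with
  | Nlat i =>
      if (i.+1 < l)%N then Sigma (lat i.+1) (lat i.+2)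
      else if odd m then Sigma (lat l) (lat l.+1)
      else Sigma (lat l.-1) (bar (lat l))
  | Ngrk mu => Sigma (grk mu.+1) (grk mu.+2)
  | Nodd => Sigma (grk k) (lat 1)
  end.

Definition vec_f (c : node m k) : 'M[F]_(m + n) :=
  match c with
  | Nlat i =>
      if (i.+1 < l)%N then Sigma (lat i.+2) (lat i.+1)
      else if odd m then Sigma (lat l.+1) (lat l)
      else Sigma (bar (lat l)) (lat l.-1)
  | Ngrk mu => - Sigma (grk mu.+2) (grk mu.+1)
  | Nodd => - Sigma (lat 1) (grk k)
  end.

(* The linear map with h_(eps_a) |-> (-1)^[a] Sigma^a_a. *)
Definition vec_h (x : weight F m k) : 'M[F]_(m + n) :=
  \sum_(i < l) x 0 (lshift k i) *: Sigma (lat i.+1) (lat i.+1)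
  + \sum_(mu < k) x 0 (rshift l mu) *: - Sigma (grk mu.+1) (grk mu.+1).

Definition vec_act (g : gen F m k) : 'M[F]_(m + n) :=
  match g with
  | Ge c => vec_e c
  | Gf c => vec_f c
  | Gh x => vec_h x
  | Gq x => diag_mx (\row_i qp (vec_h x i i)) (* [vec_h x] is diagonal *)
  end.

Definition vec : premodule F m k :=
  {| mdim := m + n; mpar := vec_par; mact := vec_act |}.

Definition sigma_tilde (b a : index_type) : 'M[F]_(m + n) :=
  E b a - ((-1) ^+ (gr b && (gr a (+) gr b)) * xi a * xi b
           * qp (wform (rho F m k) (eps F m k a - eps F m k b)))
          *: E (bar a) (bar b).

End VectorRepresentation.

(* Main.v *)
Require Import Defs.
From HB Require Import structures.
From mathcomp Require Import all_boot all_order all_algebra.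
From mathcomp Require Import reals.
From mathcomp.real_closed Require Import complex mxtens.
From mathcomp Require Import zify ring.

Set Implicit Arguments.
Unset Strict Implicit.
Unset Printing Implicit Defensive.

Import Order.TTheory GRing.Theory Num.Theory.
Local Open Scope ring_scope.

(* R acts on V (x) V as an intertwiner.  As R lies in U^- (x) U^+, its matrix is
   triangular for the order of the weights; as it commutes with the Cartan
   elements, it preserves eps_a + eps_b, so the only entries that can be nonzero
   are |a b> -> |a b>, |a b> -> |b a> and |a abar> -> |b bbar>.  Comparing
   entries in R Delta(e_c) = Delta^T(e_c) R, and the same for f_c, along an arrow
   a -> a' of f_c in V relates the entries at a to those at a', and these arrows
   join all the weights, which determines each family by induction:
   - the diagonal exponents differ from (eps_a, eps_b) by a number that is
     constant along arrows (it is rational and q is not a root of unity) and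
     changes sign under b -> bbar, hence vanishes;
   - the entries |a b> -> |b a> follow from the case where a -> b is an arrow;
   - the entries |a abar> -> |b bbar> satisfy a recurrence in a which the factor
     q^(rho, eps_b - eps_a) solves because (rho, alpha_c) = (alpha_c, alpha_c)/2.

   V is a module since the element in a Serre-type relation acts on V
   homogeneously, and its weight is not of the form eps_x - eps_y: the latter
   have l1-norm at most 2 in the basis eps_i, delta_mu.  The only exception is
   the commuting pair alpha_(l-1), alpha_l for m = 2l. *)

(** * Finite sums and matrices with few nonzero entries *)

Lemma sum_natr_delta (R : pzRingType) (L p : nat) (G : nat -> R) :
  \sum_(i < L) G i * (p == i.+1)%:R = if (0 < p <= L)%N then G p.-1 else 0.
Proof.
case: ifPn => pL.
  have pL' : (p.-1 < L)%N by lia.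
  rewrite (bigD1 (Ordinal pL')) //= prednK ?eqxx ?mulr1; last by lia.
  rewrite big1 ?addr0 // => i ip; rewrite (_ : (p == i.+1) = false) ?mulr0 //.
  by apply: contra_neqF ip => /eqP E; apply/val_inj; rewrite /= E.
rewrite big1 // => i _; rewrite (_ : (p == i.+1) = false) ?mulr0 //.
by have := ltn_ord i; lia.
Qed.

(** This is the form on one block of N labels, written in coordinates. A label p' at the middle has
    zero coordinates; otherwise exactly one of p' and N + 1 - p' lies in the range of the sum, which
    decides the sign. *)
Lemma sum_delta_form (R : pzRingType) (N p p' : nat) : (0 < p <= N)%N -> (0 < p' <= N)%N ->
  \sum_(i < N./2) ((p == i.+1)%:R - (N.+1 - p == i.+1)%N%:R)
     * ((p' == i.+1)%:R - (N.+1 - p' == i.+1)%N%:R)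
  = (p == p')%:R - (p == N.+1 - p')%N%:R :> R.
Proof.
move=> pN p'N; under eq_bigr do rewrite mulrBr.
rewrite sumrB (sum_natr_delta _ _ (fun i => (p == i.+1)%:R - (N.+1 - p == i.+1)%N%:R)).
rewrite (sum_natr_delta _ _ (fun i => (p == i.+1)%:R - (N.+1 - p == i.+1)%N%:R)).
rewrite !prednK; try lia.
rewrite (_ : (N.+1 - p == p') = (p == N.+1 - p'))%N; last by lia.
rewrite (_ : (N.+1 - p == N.+1 - p') = (p == p'))%N; last by lia.
have [E|E|E] : [\/ p' = (N.+1 - p')%N, (p' <= N./2)%N /\ (N./2 < N.+1 - p')%N
   | (N./2 < p')%N /\ (N.+1 - p' <= N./2)%N].
- case: (ltngtP p' (N.+1 - p')%N) => E; [constructor 2|constructor 3|constructor 1] => //; lia.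
- by rewrite -E !subrr.
- by rewrite ifT ?ifF ?subr0 //; lia.
- by rewrite ifF ?ifT ?sub0r ?opprB //; lia.
Qed.

Lemma sum_mxtens (V : nmodType) (d1 d2 : nat) (G : 'I_(d1 * d2) -> V) :
  \sum_z G z = \sum_(i < d1) \sum_(j < d2) G (mxtens_index (i, j)).
Proof.
rewrite pair_bigA (reindex (@mxtens_index d1 d2)) /=; first by apply: eq_bigr => -[].
by exists (@mxtens_unindex d1 d2) => ? _; rewrite ?mxtens_indexK ?mxtens_unindexK.
Qed.

Lemma sum_pick (V : nmodType) (T : finType) (G : T -> V) z0 :
  (forall z, z != z0 -> G z = 0) -> \sum_z G z = G z0.
Proof. by move=> H; rewrite (bigD1 z0) //= big1 ?addr0. Qed.

(** For the commuting pair of root vectors at the fork, [D1] and [D2] being their factors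
    q^(h/2). *)
Lemma commuting_products (R : pzRingType) n (A B D1 D2 : 'M[R]_n) :
  A *m B = B *m A -> D1 *m D2 = D2 *m D1 -> D1 *m B = B *m D1 -> D2 *m A = A *m D2 ->
  A *m D1 *m (B *m D2) - B *m D2 *m (A *m D1) = 0.
Proof.
move=> AB DD DB DA; apply/eqP; rewrite subr_eq0 -!mulmxA; apply/eqP.
rewrite (mulmxA D1) DB (mulmxA D2) DA -!mulmxA DD !mulmxA AB.
by rewrite -!mulmxA -DD.
Qed.

Lemma mulmx_neq0 (R : pzRingType) n (A B : 'M[R]_n) x y : (A *m B) x y != 0 ->
  exists2 z, A x z != 0 & B z y != 0.
Proof.
rewrite mxE => AB; have [/existsP[z]|/existsPn H] := boolP [exists z, A x z * B z y != 0].
  by move=> nz; exists z; apply: contraNneq nz => ->; rewrite ?mul0r ?mulr0.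
by case/eqP: AB; rewrite big1 // => z _; apply/eqP; rewrite -[_ == _]negbK H.
Qed.

Lemma diag_neq0 (R : pzRingType) n (f : 'rV[R]_n) x y : diag_mx f x y != 0 -> x = y.
Proof. by rewrite mxE; case: (x =P y) => // _; rewrite mulr0n eqxx. Qed.

Lemma delta2_neq0 (R : pzRingType) n (a b c d : 'I_n) (s : R) x y :
  (delta_mx a b - s *: delta_mx c d : 'M[R]_n) x y != 0 ->
  x = a /\ y = b \/ x = c /\ y = d.
Proof.
rewrite !mxE; case: (x =P a) => [->|_]; case: (y =P b) => [->|_]; try by left.
- by case: (a =P c) => [->|_]; case: (y =P d) => [->|_] /=; rewrite ?mulr0 ?subrr ?eqxx //; right.
- by case: (x =P c) => [->|_]; case: (b =P d) => [->|_] /=; rewrite ?mulr0 ?subrr ?eqxx //; right.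
- by case: (x =P c) => [->|_]; case: (y =P d) => [->|_] /=; rewrite ?mulr0 ?subrr ?eqxx //; right.
Qed.

(** * Labels by position, their mirror images, and the weights of V *)

Section VectorRmatrix.
Variables (F : numFieldType) (m k : nat).
Local Notation M := (m + k.*2)%N.
Local Notation I := 'I_(m + k.*2).
Local Notation l := (m./2).
Local Notation r := (k + m./2)%N.
Local Notation wform := (@wform F m k).
Local Notation alpha := (@alpha F m k).
Local Notation rho := (rho F m k).
Implicit Types (x y z : I) (p : nat) (u v w : weight F m k).

Definition pos x : nat := position m k (label x).
Definition par x : bool := vec_par x.

Lemma size_Iset : size (Iset m k) = M.
Proof. by rewrite size_cat !size_map !size_iota. Qed.

Lemma labelE x :
  label x = if (x < m)%N then lat x.+1 else grk (x - m).+1.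
Proof.
rewrite /label /Iset nth_cat size_map size_iota.
have xM := ltn_ord x.
case: ltnP => xm; first by rewrite (nth_map 0%N) ?size_iota // nth_iota.
by rewrite (nth_map 0%N) ?size_iota ?nth_iota //; lia.
Qed.

Lemma posE x : pos x = if (x < m)%N then (k + x.+1)%N
  else if (x < m + k)%N then (x - m).+1 else x.+1.
Proof.
rewrite /pos labelE; case: ltnP => //= xm.
by repeat case: ifP; lia.
Qed.

Lemma pos_gt0 x : (0 < pos x)%N.
Proof. by rewrite posE; repeat case: ifP; lia. Qed.

Lemma pos_leM x : (pos x <= M)%N.
Proof. by have := ltn_ord x; rewrite posE; repeat case: ifP; lia. Qed.

Lemma pos_inj : injective pos.
Proof.
move=> x y; have := ltn_ord x; have := ltn_ord y.
by rewrite !posE => ? ? E; apply/val_inj => /=; move: E; repeat case: ifP; lia.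
Qed.

Lemma pos_surj {p} : (0 < p <= M)%N -> exists x, pos x = p.
Proof.
move=> pM.
(* Inverts [posE] piece by piece: the first k odd labels, the even labels, the last k odd labels. *)
pose v := if (p <= k)%N then (m + p.-1)%N
          else if (p <= k + m)%N then (p - k).-1 else p.-1.
have vM : (v < M)%N by rewrite /v; repeat case: ifP; lia.
exists (Ordinal vM); rewrite posE /= /v.
by repeat case: ifP; lia.
Qed.

Lemma parE x : par x = (pos x <= k)%N || (k + m < pos x)%N.
Proof.
rewrite /par /vec_par posE labelE; have := ltn_ord x.
by repeat case: ifP => /=; lia.
Qed.

(** The even labels have the numbers below m and the odd ones the remaining numbers, so each block
    is reversed separately. *)
Definition br_val x : nat := if (x < m)%N then (m - x.+1)%N else (m + M - x.+1)%N.
Lemma br_subproof x : (br_val x < M)%N.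
Proof. by have := ltn_ord x; rewrite /br_val; case: ifP; lia. Qed.
Definition br x : I := Ordinal (br_subproof x).

Lemma pos_br x : pos (br x) = (M.+1 - pos x)%N.
Proof.
have := ltn_ord x; rewrite !posE /= /br_val.
by repeat case: ifP; lia.
Qed.

Lemma label_br x : label (br x) = bar m k (label x).
Proof.
have := ltn_ord x; rewrite !labelE /= /br_val.
case: (ltnP x m) => xm xM.
  by rewrite ifT /=; [congr lat|]; lia.
by rewrite ifF /=; [congr grk|]; lia.
Qed.

Lemma pos_eq x y : (x == y) = (pos x == pos y).
Proof. by rewrite (inj_eq pos_inj). Qed.

Lemma br_inv : involutive br.
Proof.
move=> x; apply: pos_inj; rewrite !pos_br.
by have := pos_gt0 x; have := pos_leM x; lia.
Qed.

Lemma br_eq x y : (br x == y) = (x == br y).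
Proof. by rewrite -{1}[y]br_inv (inj_eq (inv_inj br_inv)). Qed.

Lemma par_br x : par (br x) = par x.
Proof.
rewrite !parE pos_br; have := pos_gt0 x; have := pos_leM x.
by lia.
Qed.

Lemma eps_gtE x y : eps_gt m k (label y) (label x) = (pos y < pos x)%N.
Proof. by []. Qed.

Lemma label_inj : injective (@label m k).
Proof. by move=> x y E; apply: pos_inj; rewrite /pos E. Qed.

Lemma big_Iset (V : nmodType) (P : pred index_type) (G : index_type -> V) :
  \sum_(a <- Iset m k | P a) G a = \sum_(x : I | P (label x)) G (label x).
Proof.
by rewrite (big_nth (lat 0)) big_mkord size_Iset.
Qed.

Definition sg x : F := xi F (label x).
Definition wt x : weight F m k := eps F m k (label x).

Lemma sgK x : sg x * sg x = 1.
Proof.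
by rewrite /sg; case: (label x) => [i|mu] /=; rewrite ?mulr1 // -expr2 sqrr_sign.
Qed.

(** As n is even, mu and n + 1 - mu have opposite parities. *)
Lemma sg_br x : sg (br x) = (-1) ^+ par x * sg x.
Proof.
rewrite /sg label_br /par /vec_par; have := ltn_ord x.
rewrite labelE; case: (ltnP x m) => xm xM /=; first by rewrite mul1r.
rewrite -[RHS]exprS -signr_odd -[RHS]signr_odd; congr (_ ^+ nat_of_bool _); lia.
Qed.

Lemma E_label x y : E F m k (label x) (label y) = delta_mx x y.
Proof.
by apply/matrixP=> a b; rewrite !mxE !(inj_eq label_inj).
Qed.

Lemma Sigma_label x y : Sigma F m k (label x) (label y) =
  delta_mx x y - ((-1) ^+ (par x && (par x (+) par y)) * sg x * sg y)
     *: delta_mx (br y) (br x).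
Proof. by rewrite /Sigma -!label_br !E_label. Qed.

Lemma wformC u v : wform u v = wform v u.
Proof. by rewrite /Defs.wform; congr (_ - _); apply: eq_bigr => i _; rewrite mulrC. Qed.

Lemma wformDr u v w : wform u (v + w) = wform u v + wform u w.
Proof.
rewrite /Defs.wform addrACA -opprD -!big_split /=.
by congr (_ - _); apply: eq_bigr => i _; rewrite !mxE mulrDr.
Qed.
Lemma wformZr a u v : wform u (a *: v) = a * wform u v.
Proof.
rewrite /Defs.wform mulrBr !mulr_sumr.
by congr (_ - _); apply: eq_bigr => i _; rewrite !mxE mulrCA.
Qed.
Lemma wformNr u v : wform u (- v) = - wform u v.
Proof. by rewrite -scaleN1r wformZr mulN1r. Qed.
Lemma wformBr u v w : wform u (v - w) = wform u v - wform u w.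
Proof. by rewrite wformDr wformNr. Qed.
Lemma wform0r u : wform u 0 = 0.
Proof. by rewrite -(scale0r 0) wformZr mul0r. Qed.
Lemma wformDl u v w : wform (u + v) w = wform u w + wform v w.
Proof. by rewrite ![wform _ w]wformC wformDr. Qed.
Lemma wformBl u v w : wform (u - v) w = wform u w - wform v w.
Proof. by rewrite ![wform _ w]wformC wformBr. Qed.
Lemma wformNl u w : wform (- u) w = - wform u w.
Proof. by rewrite ![wform _ w]wformC wformNr. Qed.
Lemma wformZl a u w : wform (a *: u) w = a * wform u w.
Proof. by rewrite ![wform _ w]wformC wformZr. Qed.
Lemma wform0l u : wform 0 u = 0.
Proof. by rewrite wformC wform0r. Qed.

Lemma wtE x : wt x = if (x < m)%N
  then row_mx (\row_(j < l) ((x.+1 == j.+1)%:R - (m.+1 - x.+1 == j.+1)%N%:R)) 0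
  else row_mx 0 (\row_(j < k)
    (((x - m).+1 == j.+1)%:R - (k.*2.+1 - (x - m).+1 == j.+1)%N%:R)).
Proof. by rewrite -[wt x]/(eps F m k (label x)) labelE; case: ifP. Qed.

(** Even and odd labels have disjoint coordinates, and [sum_delta_form] treats each block. At the
    middle label for odd m the two indicators cancel, as its weight is zero. *)
Lemma wform_wt x y :
  wform (wt x) (wt y) = (-1) ^+ par x * ((x == y)%:R - (x == br y)%:R).
Proof.
have := ltn_ord x; have := ltn_ord y.
rewrite /par /vec_par labelE !wtE -[x == br y]val_eqE -[x == y]val_eqE /= /br_val.
rewrite /Defs.wform.
case: (ltnP x m) => xm; case: (ltnP y m) => ym yM xM /=.
- under eq_bigr do rewrite !row_mxEl !mxE.
  rewrite sum_delta_form // [X in _ - X]big1 ?subr0 ?mul1r; last first.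
    by move=> i _; rewrite !row_mxEr !mxE mulr0.
  by congr (_%:R - _%:R); lia.
- rewrite !big1 ?subr0.
  + by rewrite (_ : (x == y :> nat) = false) 1?(_ : (x == (m + M - y.+1)%N :> nat) = false)
         ?mulr0 ?subr0 ?mulr0 //; lia.
  + by move=> i _; rewrite !row_mxEr !mxE mul0r.
  + by move=> i _; rewrite !row_mxEl !mxE mulr0.
- rewrite !big1 ?subr0.
  + by rewrite (_ : (x == y :> nat) = false) 1?(_ : (x == (m - y.+1)%N :> nat) = false)
         ?mulr0 ?subr0 ?mulr0 //; lia.
  + by move=> i _; rewrite !row_mxEr !mxE mulr0.
  + by move=> i _; rewrite !row_mxEl !mxE mul0r.
- rewrite big1 ?sub0r; last by move=> i _; rewrite !row_mxEl !mxE mulr0.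
  under eq_bigr do rewrite !row_mxEr !mxE.
  have := @sum_delta_form F k.*2 (x - m).+1 (y - m).+1; rewrite doubleK => ->; try lia.
  by rewrite mulN1r; congr (- (_%:R - _%:R)); lia.
Qed.

Lemma wt_br x : wt (br x) = - wt x.
Proof.
rewrite !wtE /= /br_val; have := ltn_ord x; case: (ltnP x m) => xm xM.
  rewrite ifT; last by lia.
  rewrite opp_row_mx oppr0; congr (row_mx _ _); apply/rowP => j; rewrite !mxE opprB.
  by congr (_%:R - _%:R); lia.
rewrite ifF; last by lia.
rewrite opp_row_mx oppr0; congr (row_mx _ _); apply/rowP => j; rewrite !mxE opprB.
by congr (_%:R - _%:R); lia.
Qed.

(** * Simple roots as arrows between the weights of V *)

Hypotheses (m_gt2 : (2 < m)%N) (k_gt0 : (0 < k)%N).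
Section Nodes.
Implicit Types (b c d : node m k) (A B : int).

Fact index0_subproof : (0 < M)%N.
Proof. by rewrite addn_gt0 (ltn_trans _ m_gt2). Qed.
(** The inverse of [pos] on 1..M, made total by an arbitrary default. *)
Definition at_pos p : I := odflt (Ordinal index0_subproof) [pick x | pos x == p].

Lemma at_posK p : (0 < p <= M)%N -> pos (at_pos p) = p.
Proof.
move=> /pos_surj[x xp]; rewrite /at_pos; case: pickP => [y /eqP //|/(_ x)].
by rewrite xp eqxx.
Qed.

(* Numbers the nodes along the chain of weights: the arrow of [e_c] ends at the
   position [nd c], or [r.-1] for the last node when m is even, where
   [alpha c = eps_(l-1) + eps_l].  In all cases [alpha c = wt (hi c) - wt (lo c)]. *)
Definition nd c : nat :=
  match c with Nlat i => (k + i.+1)%N | Ngrk mu => mu.+1 | Nodd => k end.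

Lemma nd_range c : (0 < nd c <= r)%N.
Proof. by case: c => [i|mu|] /=; try (have := ltn_ord i); try (have := ltn_ord mu); lia. Qed.

Lemma nd_inj : injective nd.
Proof.
case=> [i|mu|] [j|nu|] //=; try (have := ltn_ord i); try (have := ltn_ord mu);
  try (have := ltn_ord j); try (have := ltn_ord nu); try lia.
- by move=> _ _ E; congr Nlat; apply/val_inj => /=; lia.
- by move=> _ _ E; congr Ngrk; apply/val_inj => /=; lia.
Qed.

Definition hi_pos c := if (nd c == r) && ~~ odd m then (nd c).-1 else nd c.
Definition hi c : I := at_pos (hi_pos c).
(** Position r.+1 carries the weight 0 if m is odd and - eps_l if m is even, so the last node fits
    the same formula as the others. *)
Definition lo c : I := at_pos (nd c).+1.

Lemma pos_hi c : pos (hi c) = hi_pos c.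
Proof.
by apply: at_posK; have := nd_range c; rewrite /hi_pos; case: ifP; lia.
Qed.

Lemma pos_lo c : pos (lo c) = (nd c).+1.
Proof. by apply: at_posK; have := nd_range c; lia. Qed.

Lemma label_at_pos p : (0 < p <= M)%N -> label (at_pos p) =
  if (p <= k)%N then grk p else if (p <= k + m)%N then lat (p - k) else grk (p - m).
Proof.
move=> pM; have := at_posK pM; rewrite posE labelE; have := ltn_ord (at_pos p).
by repeat case: ifP; (try lia) => *; congr (_ _); lia.
Qed.

Lemma label_hi c : label (hi c) =
  match c with
  | Nlat i => if (i.+1 < l)%N then lat i.+1 else if odd m then lat l else lat l.-1
  | Ngrk mu => grk mu.+1
  | Nodd => grk k
  end.
Proof.
have cr := nd_range c.
rewrite /hi label_at_pos; last by rewrite /hi_pos; case: ifP; lia.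
case: c cr => [i|mu|] /= ir; rewrite /hi_pos /=; try (have := ltn_ord i); try (have := ltn_ord mu);
by repeat case: ifP; (try lia) => *; congr (_ _); lia.
Qed.

Lemma label_lo c : label (lo c) =
  match c with
  | Nlat i => if (i.+1 < l)%N then lat i.+2 else if odd m then lat l.+1
              else bar m k (lat l)
  | Ngrk mu => grk mu.+2
  | Nodd => lat 1
  end.
Proof.
have cr := nd_range c.
rewrite /lo label_at_pos; last by lia.
case: c cr => [i|mu|] /= ir; try (have := ltn_ord i); try (have := ltn_ord mu);
by repeat case: ifP; (try lia) => *; congr (_ _); lia.
Qed.

Lemma eps_bar (a : index_type) : eps F m k (bar m k a) = - eps F m k a.
Proof.
by case: a => i /=; rewrite opp_row_mx oppr0; congr (row_mx _ _);
  apply/rowP=> j; rewrite !mxE opprB; congr (_%:R - _%:R);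
  have := ltn_ord j; lia.
Qed.

Lemma eps_mid : odd m -> eps F m k (lat l.+1) = 0.
Proof.
move=> om; rewrite -[RHS]row_mx0 /=; congr (row_mx _ _); apply/rowP => j; rewrite !mxE.
by rewrite (_ : (l.+1 == j.+1) = false) 1?(_ : (m.+1 - l.+1 == j.+1)%N = false)
  ?subrr //; have := ltn_ord j; lia.
Qed.

Lemma alphaE c : alpha c = wt (hi c) - wt (lo c).
Proof.
rewrite -[wt (lo c)]/(eps F m k (label _)) -[wt (hi c)]/(eps F m k (label _)).
rewrite label_hi label_lo; case: c => [i|mu|] //.
rewrite [LHS]/=; case: ifP => // _; case: ifP => om; first by rewrite eps_mid ?subr0.
by rewrite eps_bar opprK addrC.
Qed.

Lemma npar_hi_lo c : npar c = par (hi c) (+) par (lo c).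
Proof.
rewrite /par /vec_par label_hi label_lo; case: c => [i|mu|] //=.
by case: ifP => //; case: ifP.
Qed.

(** [kap] and [kap'] are the factors of the subtracted mirror terms in Sigma^hi_lo and
    Sigma^lo_hi. *)
Definition kap c : F :=
  (-1) ^+ (par (hi c) && (par (hi c) (+) par (lo c))) * sg (hi c) * sg (lo c).
Definition kap' c : F :=
  (-1) ^+ (par (lo c) && (par (lo c) (+) par (hi c))) * sg (lo c) * sg (hi c).

Lemma vec_eE c : vec_e F c =
  delta_mx (hi c) (lo c) - kap c *: delta_mx (br (lo c)) (br (hi c)).
Proof.
rewrite -Sigma_label label_hi label_lo; case: c => [i|mu|] //=.
by repeat case: ifP.
Qed.

(** The sign is the minus in front of [Sigma] for the nodes whose upper end is odd. *)
Lemma vec_fE c : vec_f F c = (-1) ^+ par (hi c) *: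
  (delta_mx (lo c) (hi c) - kap' c *: delta_mx (br (hi c)) (br (lo c))).
Proof.
rewrite -Sigma_label /par /vec_par label_hi label_lo; case: c => [i|mu|] /=.
- by repeat case: ifP; rewrite /= ?scale1r.
- by rewrite scaleN1r.
- by rewrite scaleN1r.
Qed.

Lemma hi_lo_neq c : hi c == lo c = false.
Proof. by rewrite pos_eq pos_hi pos_lo /hi_pos; case: ifP; lia. Qed.

Lemma hi_br_lo_neq c : hi c == br (lo c) = false.
Proof.
rewrite pos_eq pos_br pos_hi pos_lo /hi_pos; have := nd_range c; case: ifP; lia.
Qed.

Lemma lo_hi_neq c : lo c == hi c = false.
Proof. by rewrite eq_sym hi_lo_neq. Qed.

Lemma lo_br_hi_neq c : lo c == br (hi c) = false.
Proof. by rewrite eq_sym br_eq hi_br_lo_neq. Qed.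

Lemma hi_br_hi_neq c : hi c == br (hi c) = false.
Proof.
rewrite pos_eq pos_br pos_hi /hi_pos; have := nd_range c; case: ifP; lia.
Qed.

Lemma pos_hi_lt_lo c : (pos (hi c) < pos (lo c))%N.
Proof. by rewrite pos_hi pos_lo /hi_pos; case: ifP; lia. Qed.

(** * Coordinates of weight differences and of simple roots *)

(* For [p <= r], the coordinate of [wt x] along the basis weight at position p. *)
Definition crd p x : int := (pos x == p)%:Z - (pos x == M.+1 - p)%N%:Z.

(** The folded position [minn (pos x) (M.+1 - pos x)] names the only basis weight that can occur in
    [wt x]; with it the l1-bounds below become linear arithmetic. *)
Lemma crd_norm p x : (0 < p <= r)%N ->
  `|crd p x| <= (minn (pos x) (M.+1 - pos x) == p)%:Z.
Proof.
move=> pr; rewrite /crd; have := pos_gt0 x; have := pos_leM x.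
have -> : (pos x == M.+1 - p)%N = ((M.+1 - pos x)%N == p) && (pos x <= M)%N.
  by have := pos_leM x; lia.
by case: (eqVneq (pos x) p) => E; case: (eqVneq (M.+1 - pos x)%N p) => E'; lia.
Qed.

Lemma crd_sum p1 p2 p3 x : (0 < p1 <= r)%N -> (0 < p2 <= r)%N -> (0 < p3 <= r)%N ->
  p1 <> p2 -> p1 <> p3 -> p2 <> p3 ->
  `|crd p1 x| + `|crd p2 x| + `|crd p3 x| <= 1.
Proof.
move=> r1 r2 r3 n12 n13 n23; have := crd_norm x r1; have := crd_norm x r2.
have := crd_norm x r3; move: (minn _ _) => t.
by move: (Num.norm _) (Num.norm _) (Num.norm _); lia.
Qed.

Lemma wform_at_pos p x : (0 < p <= M)%N ->
  wform (wt (at_pos p)) (wt x)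
  = (-1) ^+ par (at_pos p) * (crd p x)%:~R.
Proof.
move=> pM; rewrite wform_wt; congr (_ * _); rewrite !pos_eq pos_br at_posK //.
rewrite /crd rmorphB /=; congr (_%:R - _%:R); first by rewrite eq_sym.
by have := pos_leM x; lia.
Qed.

Definition node_crd p c : int := crd p (hi c) - crd p (lo c).

Lemma node_crdE p c : (0 < p <= r)%N -> node_crd p c =
  (p == nd c)%:Z + (if nd c == r then (~~ odd m && (p.+1 == r))%:Z
                    else - (p == (nd c).+1)%:Z).
Proof.
move=> pr; rewrite /node_crd /crd pos_hi pos_lo /hi_pos; have := nd_range c.
case: (eqVneq (nd c) r) => E cr; last by rewrite /=; lia.
by case: (boolP (odd m)) => om /=; lia.
Qed.

Lemma wform_alpha p c : (0 < p <= r)%N -> wform (wt (at_pos p)) (alpha c)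
  = (-1) ^+ par (at_pos p) * (node_crd p c)%:~R.
Proof.
by move=> pr; rewrite alphaE wformBr !wform_at_pos ?rmorphB -?mulrBr //; lia.
Qed.

(** Pairing with a basis weight reads off a coordinate, and the integers embed in F, which has
    characteristic zero; weight equations over F thus become integer ones. *)
Lemma crd_of_wt_diff p (g : int) x y v : (0 < p <= r)%N ->
  wform (wt (at_pos p)) v = (-1) ^+ par (at_pos p) * g%:~R ->
  wt x - wt y = v -> crd p x - crd p y = g.
Proof.
move=> pr vg /(congr1 (wform (wt (at_pos p)))).
rewrite wformBr !wform_at_pos ?vg -?mulrBr; try lia.
move=> /(mulfI _) E; apply/eqP; rewrite -(eqr_int F) intrB.
by apply/eqP/E; rewrite signr_eq0.
Qed.

Lemma wt_diff_crd p A B b c x y : (0 < p <= r)%N ->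
  wt x - wt y = A%:~R *: alpha b + B%:~R *: alpha c ->
  crd p x - crd p y = A * node_crd p b + B * node_crd p c.
Proof.
move=> pr; apply: crd_of_wt_diff => //.
by rewrite intrD !intrM wformDr !wformZr !wform_alpha //; ring.
Qed.

Lemma crd_diff_l1 p1 p2 p3 x y :
  (0 < p1 <= r)%N -> (0 < p2 <= r)%N -> (0 < p3 <= r)%N ->
  p1 <> p2 -> p1 <> p3 -> p2 <> p3 ->
  `|crd p1 x - crd p1 y| + `|crd p2 x - crd p2 y| + `|crd p3 x - crd p3 y| <= 2.
Proof.
move=> r1 r2 r3 n12 n13 n23.
have := crd_sum x r1 r2 r3 n12 n13 n23; have := crd_sum y r1 r2 r3 n12 n13 n23.
have := ler_normB (crd p1 x) (crd p1 y); have := ler_normB (crd p2 x) (crd p2 y).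
have := ler_normB (crd p3 x) (crd p3 y).
move: (Num.norm (crd p1 x)) (Num.norm (crd p2 x)) (Num.norm (crd p3 x)).
move: (Num.norm (crd p1 y)) (Num.norm (crd p2 y)) (Num.norm (crd p3 y)).
by move: (Num.norm (_ - _)) (Num.norm (_ - _)) (Num.norm (_ - _)); lia.
Qed.

Lemma crd_diff_l1_2 p1 p2 x y : (0 < p1 <= r)%N -> (0 < p2 <= r)%N -> p1 <> p2 ->
  `|crd p1 x - crd p1 y| + `|crd p2 x - crd p2 y| <= 2.
Proof.
move=> r1 r2 n12; have E1 x' : `|crd p1 x'| + `|crd p2 x'| <= 1.
  have := crd_norm x' r1; have := crd_norm x' r2; move: (minn _ _) => t.
  by move: (Num.norm _) (Num.norm _); lia.
have := E1 x; have := E1 y; clear E1.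
have := ler_normB (crd p1 x) (crd p1 y); have := ler_normB (crd p2 x) (crd p2 y).
move: (Num.norm (crd p1 x)) (Num.norm (crd p2 x)) (Num.norm (crd p1 y)) (Num.norm (crd p2 y)).
by move: (Num.norm (_ - _)) (Num.norm (_ - _)); lia.
Qed.

Lemma wt_diff_pair A B b c x y : (nd b < nd c)%N -> A <> 0 -> B <> 0 ->
  wt x - wt y = A%:~R *: alpha b + B%:~R *: alpha c ->
  [\/ [/\ nd c = (nd b).+1, A = B & `|A| = 1],
      [/\ nd c = (nd b).+1, nd c = r, odd m & 0 < A /\ A <= B <= 2 \/ -2 <= B <= A /\ A < 0],
      [/\ nd c = (nd b).+2, nd c = r, ~~ odd m & A = B]
    | [/\ nd c = (nd b).+1, nd c = r, ~~ odd m & `|A| = 1 /\ `|B| = 1]].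
Proof.
move=> bc A0 B0 E.
have br := nd_range b; have cr := nd_range c.
have b_ne_r : (nd b == r) = false by lia.
have n1 : nd b <> nd c by lia.
have n2 : nd b <> (nd b).+1 by lia.
have n3 : nd b <> (nd c).+1 by lia.
have n4 : nd c <> (nd c).+1 by lia.
have bb : node_crd (nd b) b = 1 by rewrite node_crdE // b_ne_r; lia.
have [cb|cb] := eqVneq (nd c) (nd b).+1.
  have cB : node_crd (nd c) b = -1 by rewrite node_crdE // b_ne_r; lia.
  have [cR|cR] := eqVneq (nd c) r.
    have := crd_diff_l1_2 x y br cr n1; rewrite !(wt_diff_crd _ E) // bb cB.
    have cc : node_crd (nd c) c = 1 by rewrite node_crdE // cR eqxx; lia.
    have [om|om] /= := boolP (odd m).
      have bC : node_crd (nd b) c = 0 by rewrite node_crdE // cR eqxx om; lia.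
      by rewrite bC cc => H; constructor 2; split => //; lia.
    have bC : node_crd (nd b) c = 1 by rewrite node_crdE // cR eqxx om; lia.
    by rewrite bC cc => H; constructor 4; split => //; lia.
  have c1r : (0 < (nd c).+1 <= r)%N by lia.
  have cc : node_crd (nd c) c = 1 by rewrite node_crdE // (negPf cR); lia.
  have bC : node_crd (nd b) c = 0 by rewrite node_crdE // (negPf cR); lia.
  have sC : node_crd (nd c).+1 c = -1 by rewrite node_crdE // (negPf cR); lia.
  have sB : node_crd (nd c).+1 b = 0 by rewrite node_crdE // b_ne_r; lia.
  have := crd_diff_l1 x y br cr c1r n1 n3 n4; rewrite !(wt_diff_crd _ E) // bb cB cc bC sC sB.
  by move=> H; constructor 1; split => //; lia.
have b1r : (0 < (nd b).+1 <= r)%N by lia.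
have n5 : (nd b).+1 <> nd c by lia.
have sB : node_crd (nd b).+1 b = -1 by rewrite node_crdE // b_ne_r; lia.
have cB : node_crd (nd c) b = 0 by rewrite node_crdE // b_ne_r; lia.
have cc : node_crd (nd c) c = 1 by rewrite node_crdE //; case: ifP => [/eqP ?|?]; lia.
have bC : node_crd (nd b) c = 0 by rewrite node_crdE //; case: ifP => [/eqP ?|?]; lia.
have := crd_diff_l1 x y br b1r cr n2 n1 n5; rewrite !(wt_diff_crd _ E) // bb sB cB cc bC.
(* The root of b alone contributes 2|A| and that of c another |B|, which is too much unless they
   overlap at (nd b).+1. *)
have [sC0|sC0] := eqVneq (node_crd (nd b).+1 c) 0.
  by rewrite sC0 => H; lia.
have : nd c = r /\ ~~ odd m /\ nd c = (nd b).+2.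
  by move: sC0; rewrite node_crdE //; case: ifP => [/eqP ?|?]; case: (odd m) => /=; lia.
case=> cR [om cb2].
have -> : node_crd (nd b).+1 c = 1 by rewrite node_crdE // cR eqxx om; lia.
by move=> H; constructor 3; split => //; lia.
Qed.

(** Coefficients of opposite signs with absolute value 1 survive only at the fork, where the two
    roots differ by 2 eps_l up to sign. *)
Lemma ef_wt b c x y : b <> c -> wt x - wt y = alpha b - alpha c ->
  ~~ odd m /\ (nd b = r /\ nd c = r.-1 \/ nd b = r.-1 /\ nd c = r).
Proof.
move=> bc E; have {}bc : nd b <> nd c by move=> /nd_inj.
have [bc'|cb] := ltnP (nd b) (nd c).
  case: (@wt_diff_pair 1 (-1) b c x y) => //; first by rewrite scale1r scaleN1r.
  - by case.
  - by case=> _ _ _; lia.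
  - by case.
  - by case=> ? ? om _; split=> //; right; lia.
case: (@wt_diff_pair (-1) 1 c b x y) => //; first by lia.
- by rewrite scale1r scaleN1r [RHS]addrC.
- by case.
- by case=> _ _ _; lia.
- by case.
- by case=> ? ? om _; split=> //; left; lia.
Qed.

(** 2 alpha_s = 2 delta_k - 2 eps_1 has l1-norm 4. *)
Lemma odd_double_wt x y : wt x - wt y <> 2%:R *: alpha (Nodd m k).
Proof.
move=> E.
have r1 : (0 < k <= r)%N by lia.
have r2 : (0 < k.+1 <= r)%N by lia.
have n12 : k <> k.+1 by lia.
have := crd_diff_l1_2 x y r1 r2 n12.
have s1 : node_crd k (Nodd m k) = 1 by rewrite node_crdE //= ifF; lia.
have s2 : node_crd k.+1 (Nodd m k) = -1 by rewrite node_crdE //= ifF; lia.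
rewrite (crd_of_wt_diff (g := 2) r1 _ E); last first.
  by rewrite wformZr wform_alpha // s1; ring.
rewrite (crd_of_wt_diff (g := -2) r2 _ E); last first.
  by rewrite wformZr wform_alpha // s2; ring.
by lia.
Qed.

(** The sum has coordinates 1, 1, -1 on delta_(k-1), delta_k, eps_1, so its l1-norm exceeds 2. *)
Lemma extra_wt mu i x y :
  wform (alpha (Nodd m k)) (alpha (Ngrk m mu)) != 0 ->
  wform (alpha (Nodd m k)) (alpha (Nlat k i)) != 0 ->
  wt x - wt y
    <> alpha (Nodd m k) + (alpha (Ngrk m mu) + (alpha (Nodd m k) + alpha (Nlat k i))).
Proof.
move=> smu si E.
have mul := ltn_ord mu; have il := ltn_ord i.
have r1 : (0 < k.-1 <= r)%N by lia.
have r2 : (0 < k <= r)%N by lia.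
have r3 : (0 < k.+1 <= r)%N by lia.
(* A nonzero pairing with alpha_s forces a nonzero coordinate on delta_k or eps_1; this identifies
   mu as k-1 and i as an even neighbour of the odd node. *)
have odd_form c : wform (alpha (Nodd m k)) (alpha c) != 0 ->
    node_crd k c != 0 \/ node_crd k.+1 c != 0.
  rewrite [alpha (Nodd _ _)]alphaE wformBl /hi /lo /hi_pos /= ifF; last by lia.
  rewrite !wform_alpha //; have [->|? _] := eqVneq (node_crd k c) 0; last by left.
  by have [->|? _] := eqVneq (node_crd k.+1 c) 0; [rewrite !mulr0 subrr eqxx | right].
have muk : mu.+1 = k.-1 :> nat.
  by case: (odd_form _ smu); rewrite node_crdE //= ifF; lia.
have i1 : node_crd k.+1 (Nlat k i) = 1.
  move: (odd_form _ si); rewrite !node_crdE //=.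
  by case: (eqVneq _ r) => ?; case: (boolP (odd m)) => om /=; lia.
have i2 : node_crd k (Nlat k i) = 0.
  by rewrite !node_crdE //=; case: (eqVneq _ r) => ?; case: (boolP (odd m)) => om /=; lia.
have i3 : node_crd k.-1 (Nlat k i) = 0.
  by rewrite !node_crdE //=; case: (eqVneq _ r) => ?; case: (boolP (odd m)) => om /=; lia.
have s1 : node_crd k.-1 (Nodd m k) = 0 by rewrite node_crdE //= ifF; lia.
have s2 : node_crd k (Nodd m k) = 1 by rewrite node_crdE //= ifF; lia.
have s3 : node_crd k.+1 (Nodd m k) = -1 by rewrite node_crdE //= ifF; lia.
have m1 : node_crd k.-1 (Ngrk m mu) = 1 by rewrite node_crdE //= ifF; lia.
have m2 : node_crd k (Ngrk m mu) = -1 by rewrite node_crdE //= ifF; lia.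
have m3 : node_crd k.+1 (Ngrk m mu) = 0 by rewrite node_crdE //= ifF; lia.
have wE p : (0 < p <= r)%N -> wform (wt (at_pos p))
    (alpha (Nodd m k) + (alpha (Ngrk m mu) + (alpha (Nodd m k) + alpha (Nlat k i))))
  = (-1) ^+ par (at_pos p) * (2 * (node_crd p (Nodd m k))%:~R
      + (node_crd p (Ngrk m mu))%:~R + (node_crd p (Nlat k i))%:~R).
  move=> pr.
  rewrite (wformDr _ (alpha (Nodd m k))) (wformDr _ (alpha (Ngrk m mu))).
  rewrite (wformDr _ (alpha (Nodd m k)) (alpha (Nlat k i))) !wform_alpha //.
  by ring.
have n12 : k.-1 <> k by lia.
have n13 : k.-1 <> k.+1 by lia.
have n23 : k <> k.+1 by lia.
have := crd_diff_l1 x y r1 r2 r3 n12 n13 n23.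
rewrite (crd_of_wt_diff (g := 1) r1 _ E); last first.
  by rewrite wE // s1 m1 i3; ring.
rewrite (crd_of_wt_diff (g := 1) r2 _ E); last first.
  by rewrite wE // s2 m2 i2; ring.
rewrite (crd_of_wt_diff (g := -1) r3 _ E) //.
by rewrite wE // s3 m3 i1; ring.
Qed.

(* The square (eps_x, eps_x) of the basis weight at position p. *)
Definition isg p : int := if (p <= k)%N then -1 else 1.

Lemma sign_par_at_pos p : (0 < p <= k + m)%N ->
  (-1) ^+ par (at_pos p) = (isg p)%:~R :> F.
Proof.
move=> pr; rewrite parE at_posK; last by lia.
by rewrite /isg (_ : (k + m < p)%N = false) ?orbF; [case: ifP | lia].
Qed.

Lemma wform_alpha_lt b c : (nd b < r)%N -> wform (alpha b) (alpha c) =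
  (isg (nd b) * node_crd (nd b) c - isg (nd b).+1 * node_crd (nd b).+1 c)%:~R.
Proof.
move=> br; have b0 := nd_range b.
rewrite [alpha b]alphaE wformBl /hi /lo /hi_pos (_ : _ == r = false); last by lia.
by rewrite !wform_alpha ?sign_par_at_pos -?intrM -?intrB //; lia.
Qed.

(** At the fork the contributions of eps_(l-1) and eps_l to the pairing of the two ends cancel, and
    the last node is joined to the node r-2 instead. *)
Lemma wform_alpha_pair b c : (nd b < nd c)%N -> wform (alpha b) (alpha c) =
  (if (nd c == r) && ~~ odd m
   then if nd c == (nd b).+2 then - isg (nd b).+1 else 0
   else if nd c == (nd b).+1 then - isg (nd c) else 0)%:~R.
Proof.
move=> bc; have b0 := nd_range b; have c0 := nd_range c.
rewrite wform_alpha_lt; last by lia.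
congr (_%:~R).
have b_r : (0 < nd b <= r)%N by lia.
have sb_r : (0 < (nd b).+1 <= r)%N by lia.
have [[cr om]|ncr] : (nd c = r /\ ~~ odd m) \/ (nd c == r) && ~~ odd m = false.
  by case: eqP => ?; case: (odd m); auto.
  have -> : node_crd (nd b) c = (nd c == (nd b).+1)%:Z.
    by rewrite node_crdE // cr om eqxx; lia.
  have -> : node_crd (nd b).+1 c = (nd c == (nd b).+1)%:Z + (nd c == (nd b).+2)%:Z.
    by rewrite node_crdE // cr om eqxx; lia.
  rewrite cr eqxx om /=; have [E|_] := eqVneq r (nd b).+1.
    by rewrite (_ : _ == _ = false) ?addr0 ?mulr1 /isg ?ifF; lia.
  by rewrite add0r mulr0 add0r; case: eqP; rewrite ?mulr1 ?mulr0 ?oppr0.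
rewrite ncr.
have -> : node_crd (nd b) c = 0.
  by rewrite node_crdE //; case: eqP ncr => ? ncr /=; lia.
have -> : node_crd (nd b).+1 c = (nd c == (nd b).+1)%:Z.
  by rewrite node_crdE //; case: eqP ncr => ? ncr /=; lia.
rewrite mulr0 add0r; case: eqP => [->|]; by rewrite ?mulr1 ?mulr0 ?oppr0.
Qed.

Lemma wform_alpha_self b : wform (alpha b) (alpha b) =
  (if nd b == r then if odd m then 1 else 2
   else isg (nd b) + isg (nd b).+1)%:~R.
Proof.
have b0 := nd_range b; case: eqP => br; last first.
  have nbr : (nd b == r) = false by lia.
  rewrite wform_alpha_lt; last by lia.
  have -> : node_crd (nd b) b = 1 by rewrite node_crdE // nbr; lia.
  have -> : node_crd (nd b).+1 b = -1 by rewrite node_crdE ?nbr; lia.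
  by rewrite mulr1 mulrN1 opprK.
rewrite alphaE wformBl !wformBr !wform_wt !eqxx hi_lo_neq // lo_hi_neq //.
rewrite hi_br_hi_neq // hi_br_lo_neq // lo_br_hi_neq // !parE pos_hi pos_lo /hi_pos br eqxx.
rewrite (_ : _ || _ = false); last by case: ifP; lia.
rewrite (_ : _ || _ = false); last by lia.
rewrite (_ : (lo b == _) = odd m); last by rewrite pos_eq pos_br pos_lo br; lia.
by case: (odd m) => /=; ring.
Qed.

(** N alpha_b + alpha_c is the weight of a Serre element. For joined nodes N is at least 2, whereas
    [wt_diff_pair] leaves only N = 1, or N = 2 at the short root of type B, where N is 3. Nodes that
    are not joined leave only the fork. *)
Lemma serre_wt (N : nat) b c x y : b <> c ->
  wform (alpha b) (alpha b) != 0 /\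
    N%:R = 1 - 2 * wform (alpha b) (alpha c) / wform (alpha b) (alpha b)
  \/ N = 1%N /\ wform (alpha b) (alpha c) = 0 ->
  wt x - wt y = N%:R *: alpha b + alpha c ->
  [/\ ~~ odd m, N = 1%N, wform (alpha b) (alpha c) = 0
    & nd b = r /\ nd c = r.-1 \/ nd b = r.-1 /\ nd c = r].
Proof.
move=> bc H E.
have {}bc : nd b <> nd c by move=> /nd_inj.
have b0 := nd_range b; have c0 := nd_range c.
pose f := (if (nd b < nd c)%N then
   if (nd c == r) && ~~ odd m
   then if nd c == (nd b).+2 then - isg (nd b).+1 else 0
   else if nd c == (nd b).+1 then - isg (nd c) else 0
  else if (nd b == r) && ~~ odd m
   then if nd b == (nd c).+2 then - isg (nd c).+1 else 0
   else if nd b == (nd c).+1 then - isg (nd b) else 0).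
have fE : wform (alpha b) (alpha c) = f%:~R.
  rewrite /f; case: ltnP => bc'; first by rewrite wform_alpha_pair.
  by rewrite wformC wform_alpha_pair //; lia.
pose B := (if nd b == r then if odd m then 1 else 2 : int
   else isg (nd b) + isg (nd b).+1).
have BE : wform (alpha b) (alpha b) = B%:~R by rewrite wform_alpha_self.
have {}H : B != 0 /\ N%:Z * B = B - 2 * f \/ N = 1%N /\ f = 0.
  case: H => [[]|[-> ]]; rewrite fE; last by move/eqP; rewrite intr_eq0 => /eqP; right.
  rewrite BE intr_eq0 => B0 /(congr1 ( *%R^~ B%:~R)).
  rewrite mulrBl divfK ?intr_eq0 // mul1r => NB; left; split => //.
  by apply/eqP; rewrite -(eqr_int F) intrB !intrM -NB.
have isgE p : (p <= k)%N /\ isg p = -1 \/ (k < p)%N /\ isg p = 1.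
  by rewrite /isg; case: leqP; auto.
(* N = 0 would mean 2 f = B <> 0, but a nonzero f has the sign opposite to B. *)
have N0 : N%:Z <> 0.
  move=> N0; case: H => [[B0]|[]]; last by lia.
  rewrite N0 mul0r => Bf; have := isgE (nd b); have := isgE (nd b).+1; have := isgE (nd c).
  have := isgE (nd c).+1.
  by move: B0 Bf; rewrite /B /f; repeat case: ifP => ?; lia.
have isg0 p : - isg p <> 0 by have := isgE p; lia.
have f0 : N = 1%N -> f = 0.
  move=> N1; case: H => [[_]|[]//]; rewrite N1 mul1r.
  by clear; move: (B) (f) => ? ?; lia.
have NB : N <> 1%N -> N%:Z * B = B - 2 * f by case: H => [[]|[]].
clear H.
rewrite -[alpha c]scale1r in E.
have [bc'|cb] := ltnP (nd b) (nd c).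
  case: (@wt_diff_pair N 1 _ _ _ _ bc' N0 _ E) => //.
  - case=> cb N1 _; move: f0; rewrite fE /f bc' cb eqxx (_ : (_ == _.+2) = false); last by lia.
    move: N1 => [->] /(_ erefl); case: eqP => [br|_]; last by move/isg0.
    have [om|om] := boolP (odd m); first by move/isg0.
    by split=> //; right; lia.
  - case=> cb cr om N1; move: f0; rewrite /f bc' cb eqxx om andbF => f0.
    by exfalso; apply/isg0/f0; lia.
  - case=> cb cr om [N1]; move: f0; rewrite /f bc' cb eqxx -cb cr eqxx om => f0.
    by exfalso; apply/isg0/f0.
  - case=> cb cr om [N1 _]; split=> //; [lia | | right; lia].
    by rewrite fE f0 //; lia.
have {}cb : (nd c < nd b)%N by lia.
rewrite [RHS]addrC in E.
have ncb : (nd b < nd c)%N = false by lia.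
case: (@wt_diff_pair 1 N _ _ _ _ cb _ N0 E) => //.
- case=> bc1 N1 _; move: f0; rewrite fE /f ncb bc1 eqxx (_ : (_ == _.+2) = false); last by lia.
  move: N1 => [<-] /(_ erefl); case: eqP => [br|_]; last by move/isg0.
  have [om|om] := boolP (odd m); first by move/isg0.
  by split=> //; left; lia.
- case=> bc1 br om N1.
  have [N1'|/eqP/NB] := eqVneq N 1%N.
    move: f0; rewrite /f ncb bc1 eqxx om andbF => f0; exfalso; exact/isg0/f0.
  rewrite /f /B ncb bc1 eqxx -bc1 br eqxx om /=.
  by have := isgE r; lia.
- case=> bc1 br om [N1]; move: f0; rewrite /f ncb bc1 eqxx -bc1 br eqxx om => f0.
  by exfalso; apply/isg0/f0.
- case=> bc1 br om [_ N1]; split=> //; [lia | | left; lia].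
  by rewrite fE f0 //; lia.
Qed.

(** * Homogeneous matrices and the commutation of root vectors on V *)

Definition hom v (A : 'M[F]_M) := forall x y, A x y != 0 -> wt x - wt y = v.

Lemma hom_mul v w (A B : 'M[F]_M) : hom v A -> hom w B -> hom (v + w) (A *m B).
Proof.
by move=> Ah Bh x y /mulmx_neq0[z /Ah <- /Bh <-]; rewrite addrA subrK.
Qed.

Lemma hom_add v (A B : 'M[F]_M) : hom v A -> hom v B -> hom v (A + B).
Proof.
move=> Ah Bh x y; rewrite mxE; have [E|/Ah //] := eqVneq (A x y) 0.
by rewrite E add0r => /Bh.
Qed.

Lemma hom_scale a v (A : 'M[F]_M) : hom v A -> hom v (a *: A).
Proof. by move=> Ah x y; rewrite mxE mulf_eq0 negb_or => /andP[_ /Ah]. Qed.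

Lemma hom_opp v (A : 'M[F]_M) : hom v A -> hom v (- A).
Proof. by move=> Ah x y; rewrite mxE oppr_eq0 => /Ah. Qed.

Lemma hom_delta x y : hom (wt x - wt y) (delta_mx x y).
Proof.
by move=> a b; rewrite mxE; case: (a =P x) => [->|_];
  case: (b =P y) => [->|_] //=; rewrite eqxx. Qed.

Lemma hom_diag f : hom 0 (diag_mx f).
Proof. by move=> x y; rewrite mxE; case: (x =P y) => [->|_]; rewrite ?subrr // mulr0n eqxx. Qed.

Lemma hom_e c : hom (alpha c) (vec_e F c).
Proof.
rewrite vec_eE // alphaE; apply: hom_add; first exact: hom_delta.
apply: hom_opp; apply: hom_scale.
have := @hom_delta (br (lo c)) (br (hi c)); by rewrite !wt_br opprK addrC.
Qed.

Lemma hom_f c : hom (- alpha c) (vec_f F c).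
Proof.
rewrite vec_fE // alphaE opprB; apply: hom_scale; apply: hom_add; first exact: hom_delta.
apply: hom_opp; apply: hom_scale.
have := @hom_delta (br (hi c)) (br (lo c)); by rewrite !wt_br opprK addrC.
Qed.

Lemma latE (i j : nat) : (lat i == lat j) = (i == j). Proof. by []. Qed.
Lemma grkE (i j : nat) : (grk i == grk j) = (i == j). Proof. by []. Qed.

Lemma vec_hE v : vec_h v = diag_mx (\row_x wform v (wt x)).
Proof.
apply/matrixP=> x y; rewrite /vec_h !mxE !summxE.
have [<-|xy] := eqVneq x y; last first.
  have xyF a : (label x == a) && (label y == a) = false.
    by apply: contraNF xy => /andP[/eqP <- /eqP/label_inj ->].
  by rewrite mulr0n !big1 ?addr0 // => i _; rewrite !mxE !xyF !mulr0 subr0 ?oppr0 mulr0.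
rewrite mulr1n /Defs.wform; congr (_ + _).
  apply: eq_bigr => i _; rewrite !mxE addbb andbF expr0 !mul1r !andbb; congr (_ * _).
  rewrite wtE labelE; have := ltn_ord i; case: ifP => xm il.
    rewrite row_mxEl !mxE /=; rewrite !latE; congr (_%:R - _%:R); lia.
  by rewrite row_mxEl !mxE /= subrr.
rewrite -sumrN; apply: eq_bigr => i _; rewrite !mxE addbb andbF expr0 !mul1r !andbb.
rewrite mulrN; congr (- (_ * _)).
rewrite wtE labelE; have := ltn_ord i; have := ltn_ord x; case: ifP => xm xM il.
  by rewrite row_mxEr !mxE /= mulr0 subrr.
rewrite row_mxEr !mxE -expr2 sqrr_sign mul1r; rewrite !grkE; congr (_%:R - _%:R); lia.
Qed.

Lemma npar_D c : ~~ odd m -> (r.-1 <= nd c)%N -> par (hi c) = false /\ par (lo c) = false.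
Proof.
move=> om rc; rewrite !parE pos_hi pos_lo /hi_pos om; have := nd_range c.
by case: ifP; lia.
Qed.

Lemma sg_even x : par x = false -> sg x = 1.
Proof. by rewrite /par /vec_par /sg; case: (label x). Qed.

Lemma kapM c : kap c * kap' c = (-1) ^+ (par (hi c) (+) par (lo c)).
Proof.
rewrite /kap /kap'; have := sgK (hi c); have := sgK (lo c).
move: (sg (hi c)) (sg (lo c)) => s t st ss.
transitivity ((-1) ^+ (par (hi c) && (par (hi c) (+) par (lo c)))
  * (-1) ^+ (par (lo c) && (par (lo c) (+) par (hi c))) * (s * s) * (t * t)); first by ring.
by rewrite ss st !mulr1; case: (par _); case: (par _); rewrite /= ?mulr1 ?mul1r.
Qed.

Lemma wform_alpha_wt c x : wform (alpha c) (wt x) =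
  (-1) ^+ par (hi c) * ((x == hi c)%:R - (x == br (hi c))%:R)
  - (-1) ^+ par (lo c) * ((x == lo c)%:R - (x == br (lo c))%:R).
Proof. by rewrite alphaE wformBl !wform_wt ![_ == x]eq_sym ![_ == br x]eq_sym !br_eq. Qed.

(** Neither end of an arrow is the mirror of the other end, so the mixed products vanish. What
    remains is the undeformed relation [e_c, f_c] = h_c. *)
Lemma ef_diag c : vec_e F c *m vec_f F c
    - (-1) ^+ (npar c && npar c) *: (vec_f F c *m vec_e F c)
  = diag_mx (\row_x wform (alpha c) (wt x)).
Proof.
rewrite vec_eE // vec_fE // andbb npar_hi_lo //.
rewrite -!(scalemxAl, scalemxAr) !(mulmxBl, mulmxBr) -!(scalemxAl, scalemxAr).
rewrite !mul_delta_mx_cond !eqxx !br_eq !hi_br_lo_neq // !lo_br_hi_neq //.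
rewrite !mulr0n !mulr1n !scaler0 !subr0 ?sub0r !scalerA [kap' c * _]mulrC kapM.
apply/matrixP=> x y; rewrite !mxE wform_alpha_wt; have [<-|xy] := eqVneq x y.
  by rewrite !andbb mulr1n; case: (par _); case: (par _) => /=; ring.
have xyF z : (x == z) && (y == z) = false.
  by apply: contraNF xy => /andP[/eqP-> /eqP->].
by rewrite !xyF !mulr0n; ring.
Qed.

(** For these v one has q^v - q^(-v) = v (q - q^(-1)), so that the undeformed relation gives the
    deformed one. *)
Lemma wform_alpha_wt_small c x : let v := wform (alpha c) (wt x) in
  [\/ v = 0, v = 1 | v = -1].
Proof.
pose T (v : F) := [\/ v = 0, v = 1 | v = -1].
have H (s : bool) : (-1) ^+ s = 1 :> F \/ (-1) ^+ s = -1 :> F by case: s; auto.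
have T1 s : T ((-1) ^+ (s : bool)) by case: s; [constructor 3 | constructor 2].
have T2 s : T (- (-1) ^+ (s : bool)).
  by case: s; rewrite ?opprK; [constructor 2 | constructor 3].
rewrite /= wform_alpha_wt -/(T _).
have E1 := lo_hi_neq c; have E2 := lo_br_hi_neq c.
have E3 := hi_br_hi_neq c; have E4 := hi_lo_neq c.
have E5 := hi_br_lo_neq c.
have [->|_] := eqVneq x (hi c); first by rewrite E3 E4 E5 !subr0 mulr0 subr0 mulr1.
have [->|_] := eqVneq x (br (hi c)).
  by rewrite !br_eq br_inv E5 E4 sub0r subrr mulr0 subr0 mulrN1.
rewrite subrr mulr0 sub0r.
have [_|_] := eqVneq x (lo c); have [_|_] := eqVneq x (br (lo c)).
- by rewrite subrr mulr0 oppr0; constructor 1.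
- by rewrite subr0 mulr1.
- by rewrite sub0r mulrN1 opprK.
- by rewrite subrr mulr0 oppr0; constructor 1.
Qed.

(* The two end nodes of the fork of the type D diagram: the sum of their roots
   is 2 eps_(l-1), a difference of weights of V. *)
Definition Dpair b c :=
  ~~ odd m /\ (nd b = r /\ nd c = r.-1 \/ nd b = r.-1 /\ nd c = r).

Lemma DpairP b c : Dpair b c ->
  [/\ hi b = hi c, lo b = br (lo c), kap b = 1, kap' b = 1 &
  [/\ kap c = 1, kap' c = 1, npar b = false, npar c = false & par (hi b) = false]].
Proof.
case=> om bc; have b0 := nd_range b; have c0 := nd_range c.
have [pb1 pb2] : par (hi b) = false /\ par (lo b) = false by apply: npar_D; lia.
have [pc1 pc2] : par (hi c) = false /\ par (lo c) = false by apply: npar_D; lia.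
rewrite !npar_hi_lo // /kap /kap' pb1 pb2 pc1 pc2 !sg_even // !mulr1.
split=> //; apply: pos_inj; rewrite ?pos_br ?pos_hi ?pos_lo /hi_pos ?om ?andbT.
  by case: ifP; case: ifP; lia.
by lia.
Qed.

(** Weights do not exclude these products, so they are computed. The two arrows share [hi] and have
    mirror images as [lo]; for instance both products of the raising operators are minus the matrix
    unit from [br (hi c)] to [hi c]. *)
Lemma Dpair_comm b c : Dpair b c ->
  [/\ vec_e F b *m vec_e F c = vec_e F c *m vec_e F b,
      vec_f F b *m vec_f F c = vec_f F c *m vec_f F b
    & vec_e F b *m vec_f F c = vec_f F c *m vec_e F b].
Proof.
move=> bc; have [E1 E2 k1 k2 [k3 k4 _ _ ph]] := DpairP bc; case: bc => om _.
have E4 := hi_lo_neq c; have E5 := hi_br_lo_neq c.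
have E6 := hi_br_hi_neq c.
have E7 := lo_hi_neq c; have E8 := lo_br_hi_neq c.
have E9 : lo c == br (lo c) = false.
  by rewrite pos_eq pos_br pos_lo; have := nd_range c; lia.
rewrite !vec_eE // !vec_fE // k1 k2 k3 k4 -E1 ph E1 E2 br_inv !scale1r.
rewrite !(mulmxBl, mulmxBr) !mul_delta_mx_cond !eqxx !br_eq !br_inv ?E4 ?E5 ?E6 ?E7 ?E8 ?E9.
by rewrite !mulr0n !mulr1n !subr0 ?sub0r ?opprK.
Qed.

Lemma h_hom v w (A : 'M[F]_M) : hom w A -> vec_h v *m A - A *m vec_h v = wform v w *: A.
Proof.
move=> Ah; rewrite vec_hE mul_diag_mx mul_mx_diag; apply/matrixP=> x y; rewrite !mxE.
have [->|/Ah <-] := eqVneq (A x y) 0; first by rewrite mul0r !mulr0 subrr.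
by rewrite wformBr; ring.
Qed.

End Nodes.

(** * V is a module over the quantum superalgebra *)

Variables (q : F) (qp : F -> F).
Hypotheses (q_neq0 : q != 0) (q_aper : forall N : nat, (0 < N)%N -> q ^+ N != 1).
Hypothesis qpP : power_choice q qp.
Local Notation V := (vec m k qp).

Section Nodes.
Implicit Types b c d : node m k.

Lemma vec_qE v : vec_act qp (Gq v) = diag_mx (\row_x qp (wform v (wt x))).
Proof.
by rewrite /vec_act; congr diag_mx; apply/rowP=> i; rewrite vec_hE !mxE eqxx.
Qed.

Lemma vec_weights : has_weights qp (V := V) (fun x => wt x).
Proof. by move=> v; split; rewrite ?[LHS]vec_hE ?[LHS]vec_qE. Qed.

Lemma qpD (s t : F) : qp (s + t) = qp s * qp t. Proof. by case: qpP => ->. Qed.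
Lemma qp1 : qp 1 = q. Proof. by case: qpP. Qed.
Lemma qp_neq0 a : qp a != 0.
Proof.
have : qp (a + (1 - a)) != 0 by rewrite addrC subrK qp1.
by rewrite qpD mulf_eq0 negb_or => /andP[].
Qed.
Lemma qp0 : qp 0 = 1.
Proof. by apply: (mulfI (qp_neq0 0)); rewrite -qpD addr0 mulr1. Qed.
Lemma qpN a : qp (- a) = (qp a)^-1.
Proof. by apply: (mulfI (qp_neq0 a)); rewrite -qpD subrr qp0 divff ?qp_neq0. Qed.
Lemma qqV_neq0 : q - q^-1 != 0.
Proof.
rewrite subr_eq0; apply: contra (q_aper (isT : 0 < 2)%N) => /eqP E.
by rewrite expr2 {2}E divff.
Qed.

Lemma qp_wformB u v w : qp (wform u (v - w)) = qp (wform u v) / qp (wform u w).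
Proof. by rewrite wformBr (qpD (wform u v)) (qpN (wform u w)). Qed.

Lemma q_hom v w (A : 'M[F]_M) : hom w A ->
  vec_act qp (Gq v) *m A = qp (wform v w) *: (A *m vec_act qp (Gq v)).
Proof.
move=> Ah; rewrite vec_qE mul_diag_mx mul_mx_diag; apply/matrixP=> x y; rewrite !mxE.
have [->|/Ah <-] := eqVneq (A x y) 0; first by rewrite mul0r !mulr0.
by rewrite qp_wformB; field; rewrite qp_neq0.
Qed.

Lemma ef_rel c : vec_e F c *m vec_f F c
    - (-1) ^+ (npar c && npar c) *: (vec_f F c *m vec_e F c)
  = (q - q^-1)^-1 *: (vec_act qp (Gq (alpha c)) - vec_act qp (Gq (- alpha c))).
Proof.
rewrite ef_diag !vec_qE; apply/matrixP=> x y; rewrite !mxE -mulrnBl mulrnAr; congr (_ *+ _).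
rewrite wformNl; case: (wform_alpha_wt_small c x) => ->.
- by rewrite oppr0 subrr mulr0.
- by rewrite qpN qp1 mulVf // qqV_neq0.
- by rewrite opprK qpN qp1 -opprB mulrN mulVf // qqV_neq0.
Qed.

Definition act_ef (up : bool) c : 'M[F]_M := if up then vec_e F c else vec_f F c.
Definition updown (up : bool) v := if up then v else - v.

Lemma hom_act_ef up c : hom (updown up (alpha c)) (act_ef up c).
Proof. by case: up; [exact: hom_e | exact: hom_f]. Qed.

Lemma eval_EF up c : eval V (hval (EF F up c)) =
  act_ef up c *m vec_act qp (Gq (2%:R^-1 *: alpha c)).
Proof. by case: up. Qed.

Lemma hom_EF up c : hom (hwt (EF F up c)) (eval V (hval (EF F up c))).
Proof.
rewrite eval_EF -[hwt _]addr0; apply: hom_mul; first exact: hom_act_ef.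
by rewrite vec_qE; exact: hom_diag.
Qed.

Lemma eval_qad up c h : eval V (hval (qad qp up c h)) =
  eval V (hval (EF F up c)) *m eval V (hval h)
  - ((-1) ^+ (npar c && hpar h) * qp (wform (alpha c) (hwt h))) *:
    (eval V (hval h) *m eval V (hval (EF F up c))).
Proof. by rewrite -scaleN1r. Qed.

Lemma hom_qad up c h : hom (hwt h) (eval V (hval h)) ->
  hom (hwt (qad qp up c h)) (eval V (hval (qad qp up c h))).
Proof.
move=> hh; rewrite eval_qad; apply: hom_add.
  by apply: hom_mul => //; exact: hom_EF.
apply: hom_opp; apply: hom_scale; rewrite [hwt _]addrC.
by apply: hom_mul => //; exact: hom_EF.
Qed.

Lemma hom_iter_qad up b c N :
  hom (updown up (N%:R *: alpha b + alpha c)) (eval V (hval (iter N (qad qp up b) (EF F up c)))).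
Proof.
suff -> : updown up (N%:R *: alpha b + alpha c) = hwt (iter N (qad qp up b) (EF F up c)).
  by elim: N => [|N IH]; [exact: hom_EF | apply: hom_qad].
elim: N => [|N IH]; first by rewrite scale0r add0r.
have -> : hwt (iter N.+1 (qad qp up b) (EF F up c))
  = updown up (alpha b) + hwt (iter N (qad qp up b) (EF F up c)) by case: up {IH}.
rewrite -IH; case: up {IH} => /=; last rewrite -opprD;
  by rewrite -natr1 scalerDl scale1r -addrA addrCA.
Qed.

(** Swapping the two indices turns the weight -v into v, so the weight lemmas for raising elements
    also serve the lowering ones. *)
Lemma hom_updown_eq0 up v (A : 'M[F]_M) : hom (updown up v) A ->
  (forall x y, wt x - wt y <> v) -> A = 0.
Proof.
move=> Ah H; apply/matrixP=> x y; rewrite mxE.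
have [//|/Ah] := eqVneq (A x y) 0; case: up {Ah} => /= E; first by case: (H x y).
by case: (H y x); rewrite -[v]opprK -E opprB.
Qed.

(** The roots are orthogonal and even, so [qad] is an ordinary commutator here, and each Cartan
    factor commutes with the other root vector. *)
Lemma qad_Dpair up b c : Dpair b c -> wform (alpha b) (alpha c) = 0 ->
  eval V (hval (qad qp up b (EF F up c))) = 0.
Proof.
move=> bc f0; have [_ _ _ _ [_ _ nb _ _]] := DpairP bc.
have [ee ff _] := Dpair_comm bc.
have C : act_ef up b *m act_ef up c = act_ef up c *m act_ef up b by case: up.
have f0' : wform (alpha b) (updown up (alpha c)) = 0.
  by case: up {C}; rewrite //= wformNr f0 oppr0.
have f1' : wform (alpha c) (updown up (alpha b)) = 0.
  by case: up {C f0'}; rewrite //= ?wformNr wformC f0 ?oppr0.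
rewrite eval_qad !eval_EF nb expr0 mul1r (_ : hwt _ = updown up (alpha c));
  last by case: up {C f0' f1'}.
rewrite f0' qp0 scale1r; apply: commuting_products => //.
- by rewrite !vec_qE !mulmx_diag; congr diag_mx; apply/rowP=> x; rewrite !mxE mulrC.
- by rewrite (q_hom _ (@hom_act_ef up c)) wformZl f0' mulr0 qp0 scale1r.
- by rewrite (q_hom _ (@hom_act_ef up b)) wformZl f1' mulr0 qp0 scale1r.
Qed.

Lemma eval_serre up b c N : b <> c ->
  wform (alpha b) (alpha b) != 0 /\
    N%:R = 1 - 2 * wform (alpha b) (alpha c) / wform (alpha b) (alpha b)
  \/ N = 1%N /\ wform (alpha b) (alpha c) = 0 ->
  eval V (hval (iter N (qad qp up b) (EF F up c))) = 0.
Proof.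
move=> bc H; have := @hom_iter_qad up b c N.
have [D|D] : Dpair b c /\ N = 1%N /\ wform (alpha b) (alpha c) = 0 \/
    forall x y, wt x - wt y <> N%:R *: alpha b + alpha c.
- case: (boolP [exists x, exists y, wt x - wt y == N%:R *: alpha b + alpha c]).
    case/existsP=> x /existsP[y /eqP /(serre_wt bc H)[om N1 f0 D]].
    by left.
  move=> /existsPn E; right=> x y /eqP xy; have /existsPn /(_ y) := E x.
  by rewrite xy.
- by case: D => bcD [-> f0] _; exact: qad_Dpair.
- by move/hom_updown_eq0; apply.
Qed.

Lemma eval_gcomm px py s t : eval V (gcomm px py s t) =
  eval V s *m eval V t - (-1) ^+ (px && py) *: (eval V t *m eval V s).
Proof. by rewrite -scaleN1r. Qed.

Lemma hom_gcomm px py s t v w : hom v (eval V s) -> hom w (eval V t) ->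
  hom (v + w) (eval V (gcomm px py s t)).
Proof.
move=> sv tw; rewrite eval_gcomm; apply: hom_add; first exact: hom_mul.
by apply: hom_opp; apply: hom_scale; rewrite addrC; apply: hom_mul.
Qed.

Lemma eval_Zero : eval V (Zero F m k) = 0.
Proof. by rewrite /= scale0r. Qed.

Lemma updown_sum4 up u v w t :
  updown up (u + (v + (w + t)))
  = updown up u + (updown up v + (updown up w + updown up t)).
Proof. by case: up => //; rewrite /updown !opprD. Qed.

Lemma vec_rel s t : Defs.rel q qp s t -> eval V s = eval V t.
Proof.
case=> {s t}.
- move=> a u v; rewrite [LHS]vec_hE // [RHS]/= !vec_hE //.
  by apply/matrixP=> x y; rewrite !mxE wformDl wformZl; case: (x == y);
    rewrite ?mulr1n // !mulr0n mulr0 addr0.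
- rewrite [LHS]vec_qE; apply/matrixP=> x y; rewrite !mxE wform0l qp0.
  by rewrite eq_sym.
- move=> u v; rewrite -[RHS]/(vec_act qp (Gq u) *m vec_act qp (Gq v))
    [LHS]vec_qE !vec_qE mulmx_diag.
  by congr diag_mx; apply/rowP=> x; rewrite !mxE wformDl (qpD (wform u _)).
- move=> u v; rewrite [LHS]/= [RHS]/= !vec_hE // !mulmx_diag.
  by congr diag_mx; apply/rowP=> x; rewrite !mxE mulrC.
- move=> u v; rewrite -[RHS]/(vec_act qp (Gq v) *m vec_h u) -[LHS]/(vec_h u *m vec_act qp (Gq v)).
  rewrite !vec_hE // !vec_qE !mulmx_diag.
  by congr diag_mx; apply/rowP=> x; rewrite !mxE mulrC.
- by move=> u c; rewrite eval_gcomm expr0 scale1r; exact: (h_hom u (@hom_act_ef true c)).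
- by move=> u c; rewrite eval_gcomm expr0 scale1r -wformNr; exact: (h_hom u (@hom_act_ef false c)).
- by move=> u c; exact: (q_hom u (@hom_act_ef true c)).
- by move=> u c; rewrite -wformNr; exact: (q_hom u (@hom_act_ef false c)).
- move=> c; rewrite eval_gcomm
    -[RHS]/((q - q^-1)^-1 *: (vec_act qp (Gq (alpha c)) + -1 *: vec_act qp (Gq (- alpha c)))).
  rewrite scaleN1r; exact: (ef_rel c).
(* Either alpha_c - alpha_d is no difference of weights of V, or c and d are the ends of the fork,
   where e_c and f_d commute. *)
- move=> c d cd; rewrite eval_Zero.
  have H := @hom_gcomm (npar c) (npar d) (gen_e F c) (gen_f F d) _ _
    (@hom_act_ef true c) (@hom_act_ef false d).
  case: (boolP [exists x, exists y, wt x - wt y == alpha c - alpha d]).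
    case/existsP=> x /existsP[y /eqP /(ef_wt cd) D].
    have [_ _ _ _ [_ _ nc _ _]] := DpairP D.
    have [_ _ E] := Dpair_comm D.
    by rewrite eval_gcomm nc expr0 scale1r; apply/eqP; rewrite subr_eq0; apply/eqP.
  move=> /existsPn E; apply: (@hom_updown_eq0 true _ _ H) => x y /eqP xy.
  by have /existsPn /(_ y) := E x; rewrite xy.
(* For an even node the graded commutator is e e - e e; only the odd node needs the weight 2
   alpha_s. *)
- case=> [i|mu|] _; rewrite eval_Zero; try by rewrite eval_gcomm expr0 scale1r subrr.
  apply: (@hom_updown_eq0 true (alpha (Nodd m k) + alpha (Nodd m k))).
    exact: (@hom_gcomm _ _ (gen_e F (Nodd m k)) (gen_e F (Nodd m k)) _ _
      (@hom_act_ef true (Nodd m k)) (@hom_act_ef true (Nodd m k))).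
  by move=> x y; rewrite -mulr2n -scaler_nat; exact: odd_double_wt.
- case=> [i|mu|] _; rewrite eval_Zero; try by rewrite eval_gcomm expr0 scale1r subrr.
  apply: (@hom_updown_eq0 false (alpha (Nodd m k) + alpha (Nodd m k))).
    have -> : updown false (alpha (Nodd m k) + alpha (Nodd m k)) =
      updown false (alpha (Nodd m k)) + updown false (alpha (Nodd m k)) by exact: opprD.
    exact: (@hom_gcomm _ _ (gen_f F (Nodd m k)) (gen_f F (Nodd m k)) _ _
      (@hom_act_ef false (Nodd m k)) (@hom_act_ef false (Nodd m k))).
  by move=> x y; rewrite -mulr2n -scaler_nat; exact: odd_double_wt.
- by move=> up b c N bc B0 NE; rewrite eval_Zero; apply: eval_serre => //; left.
- move=> up b c bc _ f0; rewrite eval_Zero.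
  by have := @eval_serre up b c 1%N bc; apply; right.
- move=> up mu i smu si; rewrite eval_Zero.
  apply: (hom_updown_eq0 (up := up)); last by move=> x y; apply: extra_wt smu si.
  have : hom (hwt (qad qp up (Nodd m k) (qad qp up (Ngrk m mu)
                  (qad qp up (Nodd m k) (EF F up (Nlat k i))))))
    (eval V (hval (qad qp up (Nodd m k) (qad qp up (Ngrk m mu)
                  (qad qp up (Nodd m k) (EF F up (Nlat k i))))))).
    by do 3 apply: hom_qad; exact: hom_EF.
  by rewrite updown_sum4; case: up.
- move=> up mu i smu si; rewrite eval_Zero.
  apply: (hom_updown_eq0 (up := up)); last by move=> x y; apply: extra_wt smu si.
  have : hom (hwt (qad qp up (Nodd m k) (qad qp up (Nlat k i)
                  (qad qp up (Nodd m k) (EF F up (Ngrk m mu))))))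
    (eval V (hval (qad qp up (Nodd m k) (qad qp up (Nlat k i)
                  (qad qp up (Nodd m k) (EF F up (Ngrk m mu))))))).
    by do 3 apply: hom_qad; exact: hom_EF.
  (* Both extra relations have the same weight, so [extra_wt] serves here too. *)
  have -> : alpha (Nodd m k) + (alpha (Ngrk m mu) + (alpha (Nodd m k) + alpha (Nlat k i)))
    = alpha (Nodd m k) + (alpha (Nlat k i) + (alpha (Nodd m k) + alpha (Ngrk m mu))).
    by congr (_ + _); rewrite addrCA [RHS]addrCA; congr (_ + _); exact: addrC.
  by rewrite updown_sum4; case: up.
Qed.

Lemma vec_e_neq0 c x y : vec_e F c x y != 0 ->
  x = hi c /\ y = lo c \/ x = br (lo c) /\ y = br (hi c).
Proof. by rewrite vec_eE // => /delta2_neq0. Qed.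

Lemma vec_f_neq0 c x y : vec_f F c x y != 0 ->
  x = lo c /\ y = hi c \/ x = br (hi c) /\ y = br (lo c).
Proof. by rewrite vec_fE // mxE mulf_eq0 negb_or => /andP[_ /delta2_neq0]. Qed.

Lemma vec_parity g x y : vec_act qp g x y != 0 -> par x (+) par y = gpar g.
Proof.
case: g => [c|c|v|v]; rewrite [gpar _]/= ?npar_hi_lo //.
- by case/vec_e_neq0=> -[-> ->] //; rewrite !par_br addbC.
- by case/vec_f_neq0=> -[-> ->] //; rewrite ?par_br // addbC.
- by rewrite /= vec_hE // => /diag_neq0 ->; rewrite addbb.
- by rewrite vec_qE => /diag_neq0 ->; rewrite addbb.
Qed.

Lemma vec_is_module : is_module q qp V.
Proof.
split; first exact: vec_rel.
  by move=> g i j; exact: vec_parity.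
by exists (fun x => wt x); exact: vec_weights.
Qed.

End Nodes.

(** * Which entries of R can be nonzero *)

Variable Rmat : family2 F m k.
Hypotheses (R_univ : universal_Rmatrix q qp Rmat)
  (R_comp : in_completed_Uminus_Uplus q qp Rmat)
  (R_cartan : rational_Cartan_part q qp Rmat).
Implicit Type c : node m k.

(* The coefficient of |b1 b2> in R |a1 a2>. *)
Definition Rent (b1 b2 a1 a2 : I) : F :=
  Rmat V V (mxtens_index (b1, b2)) (mxtens_index (a1, a2)).

Lemma gtensE (A B : 'M[F]_M) (x1 x2 y1 y2 : I) :
  gtens par par A B (mxtens_index (x1, x2)) (mxtens_index (y1, y2))
  = (-1) ^+ ((par x2 (+) par y2) && par y1) * (A x1 y1 * B x2 y2).
Proof. by rewrite mxE !mxtens_indexK. Qed.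

Lemma vec_e_raises c x y : vec_e F c x y != 0 -> (pos x < pos y)%N.
Proof.
have lt := pos_hi_lt_lo c.
move=> /vec_e_neq0[[-> ->]//|[-> ->]].
by rewrite !pos_br; have := pos_leM (lo c); lia.
Qed.

Lemma vec_f_lowers c x y : vec_f F c x y != 0 -> (pos y < pos x)%N.
Proof.
have lt := pos_hi_lt_lo c.
move=> /(vec_f_neq0)[[-> ->]//|[-> ->]].
by rewrite !pos_br; have := pos_leM (lo c); lia.
Qed.

Lemma eval_lower s : in_Uminus s -> forall x y, eval V s x y != 0 -> (pos y <= pos x)%N.
Proof.
elim: s => [[c|c|v|v]||t s IH|s IHs t IHt|s IHs t IHt] // H x y.
- by move/vec_f_lowers/ltnW.
- by rewrite [eval _ _]/= vec_hE // => /diag_neq0 ->.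
- by rewrite [eval _ _]vec_qE => /diag_neq0 ->.
- by rewrite mxE; case: (x =P y) => [->|_]; rewrite ?eqxx.
- by rewrite mxE mulf_eq0 negb_or => /andP[_]; exact: IH.
- case/andP: H => Hs Ht; rewrite mxE; have [E|/(IHs Hs) //] := eqVneq (eval V s x y) 0.
  by rewrite E add0r; exact: IHt.
- case/andP: H => Hs Ht /mulmx_neq0[z /(IHs Hs) ? /(IHt Ht) ?].
  by apply: leq_trans; eassumption.
Qed.

Lemma eval_raise s : in_Uplus s -> forall x y, eval V s x y != 0 -> (pos x <= pos y)%N.
Proof.
elim: s => [[c|c|v|v]||t s IH|s IHs t IHt|s IHs t IHt] // H x y.
- by move/vec_e_raises/ltnW.
- by rewrite [eval _ _]/= vec_hE // => /diag_neq0 ->.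
- by rewrite [eval _ _]vec_qE => /diag_neq0 ->.
- by rewrite mxE; case: (x =P y) => [->|_]; rewrite ?eqxx.
- by rewrite mxE mulf_eq0 negb_or => /andP[_]; exact: IH.
- case/andP: H => Hs Ht; rewrite mxE; have [E|/(IHs Hs) //] := eqVneq (eval V s x y) 0.
  by rewrite E add0r; exact: IHt.
- case/andP: H => Hs Ht /mulmx_neq0[z /(IHs Hs) ? /(IHt Ht) ?].
  by apply: leq_trans; eassumption.
Qed.

(** On V (x) V, R acts as one finite sum of tensors in U^- (x) U^+: the first legs move weights
    down, the second legs up. *)
Lemma R_tri (b1 b2 a1 a2 : I) : Rent b1 b2 a1 a2 != 0 ->
  (pos a1 <= pos b1)%N /\ (pos b2 <= pos a2)%N.
Proof.
rewrite /Rent; have [t] := @R_comp 1 (fun=> V) (fun=> V)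
  (fun=> vec_is_module) (fun=> vec_is_module).
move=> tUU /(_ ord0) ->; rewrite /eval2.
elim: t tUU => [|[s1 s2] t IH] /=; first by rewrite big_nil mxE eqxx.
case/andP=> /andP[U1 U2] /IH{}IH; rewrite big_cons mxE.
set A := eval V s1; set B := eval V s2.
rewrite [X in X + _]gtensE -/A -/B.
have [->|h1] := eqVneq (A b1 a1) 0; first by rewrite mul0r mulr0 add0r.
have [->|h2] := eqVneq (B b2 a2) 0; first by rewrite !mulr0 add0r.
by move=> _; split; [apply: eval_lower h1 | apply: eval_raise h2].
Qed.

Lemma R_intertwines_entry g (b1 b2 a1 a2 : I) :
  \sum_z1 \sum_z2 Rent b1 b2 z1 z2 *
    eval2 V V (coprod g) (mxtens_index (z1, z2)) (mxtens_index (a1, a2))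
  = \sum_z1 \sum_z2
      gtwist par par (eval2 V V (coprod g))
        (mxtens_index (b1, b2)) (mxtens_index (z1, z2)) * Rent z1 z2 a1 a2.
Proof.
have := uR_intertwines R_univ vec_is_module vec_is_module (Gen g).
move=> /matrixP /(_ (mxtens_index (b1, b2)) (mxtens_index (a1, a2))).
by rewrite mxE [RHS]mxE !sum_mxtens.
Qed.

(** The eigenvalue of q^(h_c/2) on |x>. *)
Definition halfq c x : F := qp (2%:R^-1 * wform (alpha c) (wt x)).

Lemma eval2_ef up c (z1 z2 a1 a2 : I) :
  eval2 V V (coprod (if up then Ge F c else Gf F c))
    (mxtens_index (z1, z2)) (mxtens_index (a1, a2))
  = (-1) ^+ ((par z2 (+) par a2) && par a1)
      * (halfq c a1 * (z1 == a1)%:R * act_ef up c z2 a2)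
    + act_ef up c z1 a1 * ((halfq c a2)^-1 * (z2 == a2)%:R).
Proof.
have hq v x y : eval V (gen_q v) x y = qp (wform v (wt y)) * (x == y)%:R.
  by rewrite [eval _ _]vec_qE !mxE; case: (x =P y) => [->|_]; rewrite ?mulr1 ?mulr0.
have -> : coprod (if up then Ge F c else Gf F c) =
    [:: (gen_q (2%:R^-1 *: alpha c), if up then gen_e F c else gen_f F c);
        (if up then gen_e F c else gen_f F c, gen_q (- (2%:R^-1 *: alpha c)))].
  by case: up.
rewrite /eval2 !big_cons big_nil addr0 mxE [X in X + _]gtensE [X in _ + X]gtensE.
have -> : eval V (if up then gen_e F c else gen_f F c) = act_ef up c by case: up.
rewrite [(_, _).1]/= [(_, _).2]/= !hq wformNl qpN wformZl -!/(halfq _ _).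
congr (_ * _ + _).
have [->|_] := eqVneq z2 a2; last by rewrite !mulr0.
by rewrite addbb expr0 mul1r /halfq wformZl.
Qed.

Lemma crd_pos x y : crd (pos x) y = (y == x)%:Z - (y == br x)%:Z.
Proof. by rewrite /crd !pos_eq pos_br. Qed.

Lemma crd_br p x : (0 < p <= M)%N -> crd p (br x) = - crd p x.
Proof.
move=> pM; rewrite /crd pos_br opprB; have := pos_gt0 x; have := pos_leM x.
move: (pos x) => t t1 t2; have -> : (M.+1 - t == p)%N = (t == M.+1 - p)%N by lia.
by have -> : (M.+1 - t == M.+1 - p)%N = (t == p) by lia.
Qed.

(** A label different from its mirror has coordinate 1 at its own position; only the middle label
    has all coordinates zero, and it is unique. *)
Lemma crd_inj x y : (forall p, (0 < p <= M)%N -> crd p x = crd p y) -> x = y.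
Proof.
move=> H; have Hp z : crd (pos z) x = crd (pos z) y.
  by apply: H; rewrite pos_gt0 pos_leM.
have := Hp y; have := Hp x; rewrite !crd_pos !eqxx.
have [//|_] := eqVneq x y.
have [xx|_] := eqVneq x (br x); last by lia.
have [yy|_] := eqVneq y (br y); last by lia.
by move=> _ _; apply: pos_inj; have := pos_br x; have := pos_br y; rewrite -xx -yy; lia.
Qed.

Lemma crd_sum_eq (a1 a2 b1 b2 : I) :
  (forall p, (0 < p <= M)%N -> crd p a1 + crd p a2 = crd p b1 + crd p b2) ->
  [\/ b1 = a1 /\ b2 = a2, b1 = a2 /\ b2 = a1 | a2 = br a1 /\ b2 = br b1].
Proof.
move=> H.
have [E|n11] := eqVneq a1 b1.
  by constructor 1; split=> //; apply: crd_inj => p /H; rewrite E => /addrI.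
have [E|n12] := eqVneq a1 b2.
  by constructor 2; split=> //; apply: crd_inj => p /H; rewrite E addrC => /addIr.
have pM x : (0 < pos x <= M)%N by rewrite pos_gt0 pos_leM.
have brP x y : (forall p, (0 < p <= M)%N -> crd p x + crd p y = 0) -> y = br x.
  by move=> H0; apply: crd_inj => p pr; rewrite crd_br //; have := H0 _ pr; lia.
have [E|n2] := eqVneq a2 (br a1).
  constructor 3; split=> //; apply: brP => p pr.
  by rewrite -H // E crd_br // subrr.
have := H _ (pM a1); rewrite !crd_pos eqxx ![_ == a1]eq_sym (negPf n11) (negPf n12) (negPf n2).
(* The coordinate at [pos a1] is positive on the left and not on the right, unless a1 is the middle
   label of weight zero. *)
have [a11|_] := eqVneq a1 (br a1); last first.
  by lia.
move=> _.
have a10 p : (0 < p <= M)%N -> crd p a1 = 0.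
  by move=> pr; have := crd_br a1 pr; rewrite -a11; lia.
have {}H p : (0 < p <= M)%N -> crd p a2 = crd p b1 + crd p b2.
  by move=> pr; rewrite -H // a10 // add0r.
have := H _ (pM a2); rewrite !crd_pos eqxx.
have [a22|_] := eqVneq a2 (br a2).
  by case/eqP: n2; apply: brP => p pr; rewrite a10 //; have := crd_br a2 pr; rewrite -a22; lia.
have [E|_] := eqVneq b1 a2.
  case/eqP: n12; apply: crd_inj => p pr; rewrite a10 //; have := H _ pr; rewrite E; lia.
have [E|_] := eqVneq b2 a2.
  case/eqP: n11; apply: crd_inj => p pr; rewrite a10 //; have := H _ pr; rewrite E; lia.
by lia.
Qed.

(** Commuting with h_v for every v forces equal total weights; [crd_sum_eq] then lists the
    possibilities. *)
Lemma R_cons (b1 b2 a1 a2 : I) : Rent b1 b2 a1 a2 != 0 ->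
  [\/ b1 = a1 /\ b2 = a2, b1 = a2 /\ b2 = a1 | a2 = br a1 /\ b2 = br b1].
Proof.
move=> R0.
have E v : wform v (wt a1) + wform v (wt a2) = wform v (wt b1) + wform v (wt b2).
  apply: (mulfI R0).
  have hE (x1 x2 y1 y2 : I) : eval2 V V (coprod (Gh v))
      (mxtens_index (x1, x2)) (mxtens_index (y1, y2))
    = (wform v (wt y1) + wform v (wt y2)) * ((x1 == y1)%:R * (x2 == y2)%:R).
    rewrite /eval2 !big_cons big_nil addr0 mxE [X in X + _]gtensE [X in _ + X]gtensE.
    rewrite [(_, _).1]/= [(_, _).2]/= [eval V _]vec_hE // [eval V (One _ _ _)]/= !mxE.
    have [->|_] := eqVneq x1 y1; have [->|_] := eqVneq x2 y2;
      rewrite ?addbb ?mulr1n ?mulr0n ?(mulr0, mul0r, addr0, mul1r, mulr1) //.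
  have := R_intertwines_entry (Gh v) b1 b2 a1 a2.
  rewrite (sum_pick (z0 := a1)); last first.
    by move=> z za; rewrite big1 // => z2 _; rewrite hE (negPf za) mul0r !mulr0.
  rewrite (sum_pick (z0 := a2)); last first.
    by move=> z za; rewrite hE (negPf za) !mulr0.
  rewrite (sum_pick (z0 := b1)); last first.
    move=> z; rewrite eq_sym => za; rewrite big1 // => z2 _.
    by rewrite mxE !mxtens_indexK hE (negPf za) !mulr0 mul0r.
  rewrite (sum_pick (z0 := b2)); last first.
    move=> z; rewrite eq_sym => za.
    by rewrite mxE !mxtens_indexK hE (negPf za) mul0r !mulr0 mul0r.
  rewrite mxE !mxtens_indexK !hE !eqxx !mulr1 addbb expr0 mul1r => ->.
  by rewrite mulrC [X in _ * X]addrC.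
apply: crd_sum_eq => p pM; apply/eqP.
rewrite -(eqr_int F) (intrD _ (crd p a1)) (intrD _ (crd p b1)); apply/eqP.
have := E (wt (at_pos p)); rewrite !wform_at_pos // -!mulrDr => /(mulfI _); apply.
by rewrite signr_eq0.
Qed.

Lemma R_cons0 (b1 b2 a1 a2 : I) : ~ (b1 = a1 /\ b2 = a2) -> ~ (b1 = a2 /\ b2 = a1) ->
  ~ (a2 = br a1 /\ b2 = br b1) -> Rent b1 b2 a1 a2 = 0.
Proof. by move=> n1 n2 n3; apply/eqP; apply: contraT => /R_cons[]. Qed.

(** One matrix entry of the intertwining relation for e_c or f_c. On each side the root vector acts
    on one of the two tensor factors, while the other factor only receives a power of q. *)
Lemma intertwine up c (b1 b2 a1 a2 : I) :
  \sum_z Rent b1 b2 a1 z * ((-1) ^+ ((par z (+) par a2) && par a1) * halfq c a1 * act_ef up c z a2)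
  + \sum_z Rent b1 b2 z a2 * (act_ef up c z a1 / halfq c a2)
  = \sum_z act_ef up c b1 z * halfq c b2 * Rent z b2 a1 a2
  + \sum_z (-1) ^+ ((par b2 (+) par z) && par b1) * act_ef up c b2 z / halfq c b1 * Rent b1 z a1 a2.
Proof.
set A := act_ef up c; set K := halfq c.
have := R_intertwines_entry (if up then Ge F c else Gf F c) b1 b2 a1 a2.
under eq_bigr do under eq_bigr do rewrite eval2_ef mulrDr.
under eq_bigr do rewrite big_split /=.
rewrite big_split /= (sum_pick (z0 := a1)); last first.
  by move=> z za; rewrite big1 // => z2 _; rewrite (negPf za) mulr0 mul0r !mulr0.
rewrite [X in _ + X]exchange_big /= [X in _ + X](sum_pick (z0 := a2)); last first.
  by move=> z za; rewrite big1 // => z2 _; rewrite (negPf za) !mulr0.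
have T z1 z2 : gtwist par par
    (eval2 V V (coprod (if up then Ge F c else Gf F c)))
    (mxtens_index (b1, b2)) (mxtens_index (z1, z2)) =
    A b1 z1 * (K b2 * (b2 == z2)%:R)
    + (-1) ^+ ((par b2 (+) par z2) && par b1) * (A b2 z2 / K b1 * (b1 == z1)%:R).
  rewrite mxE !mxtens_indexK eval2_ef -/A -/K mulrDr.
  congr (_ + _).
    have [->|_] := eqVneq b2 z2; last by rewrite !(mulr0, mul0r).
    rewrite [LHS]mulrA -signr_addb !mulr1 [K z2 * _]mulrC.
    by rewrite (_ : _ (+) _ = false) ?mul1r //; case: (par b1); case: (par z1); case: (par z2).
  have [->|_] := eqVneq b1 z1; last by rewrite !(mulr0, mul0r).
  by rewrite !mulr1; congr ((-1) ^+ (nat_of_bool _) * _);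
    case: (par z1); case: (par z2); case: (par b2).
under [X in _ = X -> _]eq_bigr do under eq_bigr do rewrite T mulrDl.
under [X in _ = X -> _]eq_bigr do rewrite big_split /=.
rewrite [X in _ = X -> _]big_split /=.
rewrite [X in _ = X + _ -> _]exchange_big /= [X in _ = X + _ -> _](sum_pick (z0 := b2)); last first.
  by move=> z; rewrite eq_sym => za; rewrite big1 // => z2 _; rewrite (negPf za) !(mulr0, mul0r).
rewrite [X in _ = _ + X -> _](sum_pick (z0 := b1)); last first.
  by move=> z; rewrite eq_sym => za; rewrite big1 // => z2 _; rewrite (negPf za) !(mulr0, mul0r).
move=> E; apply: etrans (etrans E _); congr (_ + _); apply: eq_bigr => z _;
by rewrite !eqxx !mulr1 ?mulrA.
Qed.

(** * Arrows between weights and their mirror images *)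

(** Rows and columns of e_c and f_c on V have at most one nonzero entry; recording this reduces sums
    in [intertwine] to single terms. *)
Definition step up c (a a' : I) (s : F) := [/\ s * s = 1,
  forall z, act_ef up c z a = s * (z == a')%:R &
  forall z, act_ef up c a' z = s * (z == a)%:R].

(* An arrow a -> a' of f_c together with its mirror image abar' -> abar, with
   coefficients [s] and [s'].  [edge_sign] is what makes the coefficient
   (-1)^[a] xi_a of the final formula satisfy the recurrence in a. *)
Record edge c (a a' : I) (s s' : F) : Prop := Edge {
  edge_step : step false c a a' s;
  edge_step_br : step false c (br a') (br a) s';
  edge_up : exists t, step true c a' a t;
  edge_wt : alpha c = wt a - wt a';
  edge_pos : (pos a < pos a')%N;
  edge_br : a' != br a;
  edge_sign : s * (-1) ^+ par a' * sg a'
    = - s' * (-1) ^+ ((par a (+) par a') && par a) * (-1) ^+ par a * sg a }.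

Lemma kap'_sqr c : kap' c * kap' c = 1.
Proof.
rewrite /kap'; have := sgK (hi c); have := sgK (lo c).
move: (sg (hi c)) (sg (lo c)) => s t ss tt.
by rewrite -mulrA mulrACA -expr2 sqrr_sign mul1r mulrACA ss tt mulr1.
Qed.

Lemma kap_sqr c : kap c * kap c = 1.
Proof.
rewrite /kap; have := sgK (hi c); have := sgK (lo c).
move: (sg (hi c)) (sg (lo c)) => s t ss tt.
by rewrite -mulrA mulrACA -expr2 sqrr_sign mul1r mulrACA ss tt mulr1.
Qed.

Lemma edge_hi_lo c :
  edge c (hi c) (lo c) ((-1) ^+ par (hi c)) (- (-1) ^+ par (hi c) * kap' c).
Proof.
have E1 := hi_lo_neq c; have E2 := hi_br_lo_neq c.
have E3 := lo_hi_neq c; have E4 := lo_br_hi_neq c.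
have ss (b : bool) : (-1) ^+ b * (-1) ^+ b = 1 :> F by rewrite -expr2 sqrr_sign.
split.
- split=> // z; rewrite /act_ef vec_fE // !mxE eqxx ?br_eq ?E2 ?E4 ?andbT ?andbF /= mulr0 subr0 //.
- split=> [|z|z]; last 2 first.
  + by rewrite /act_ef vec_fE // !mxE eqxx !br_eq ?E2 ?E4 ?andbT ?andbF /=; ring.
  + by rewrite /act_ef vec_fE // !mxE eqxx !br_eq ?E2 ?E4 ?andbT ?andbF /=; ring.
  + rewrite mulrACA kap'_sqr mulr1 mulrNN; exact: ss.
- exists 1; split=> [|z|z]; first by rewrite mulr1.
  + by rewrite /act_ef vec_eE // !mxE eqxx E4 ?andbT ?andbF /=; ring.
  + by rewrite /act_ef vec_eE // !mxE eqxx E2 ?andbT ?andbF /=; ring.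
- exact: alphaE.
- exact: pos_hi_lt_lo.
- by rewrite E4.
- rewrite /kap'; have := sgK (hi c).
  move: (sg _) (sg _) => s t tt.
  have st : s = s * (t * t) by rewrite tt mulr1.
  rewrite [in LHS]st.
  by case: (par (hi c)); case: (par (lo c)); rewrite /= ?expr0 ?expr1; ring.
Qed.

Lemma edge_br_lo_hi c :
  edge c (br (lo c)) (br (hi c)) (- (-1) ^+ par (hi c) * kap' c) ((-1) ^+ par (hi c)).
Proof.
have E1 := hi_lo_neq c; have E2 := hi_br_lo_neq c.
have E3 := lo_hi_neq c; have E4 := lo_br_hi_neq c.
have [S1 S2 _ W P _ _] := edge_hi_lo c.
split; rewrite ?br_inv //.
- exists (- kap c); split=> [|z|z]; first by rewrite mulrNN kap_sqr.
  + by rewrite /act_ef vec_eE // !mxE eqxx !br_eq E2 ?andbT ?andbF /=; ring.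
  + by rewrite /act_ef vec_eE // !mxE eqxx !br_eq E4 ?andbT ?andbF /=; ring.
- by rewrite !wt_br opprK addrC.
- by rewrite !pos_br; have := pos_leM (lo c); lia.
- by rewrite br_eq E2.
- rewrite !par_br !sg_br /kap'; have := sgK (hi c).
  move: (sg _) (sg _) => s t tt.
  have st : s = s * (t * t) by rewrite tt mulr1.
  rewrite [in RHS]st.
  by case: (par (hi c)); case: (par (lo c)); rewrite /= ?expr0 ?expr1; ring.
Qed.

Lemma nd_surj p : (0 < p <= r)%N -> exists c, nd c = p.
Proof.
move=> pr; have [pk|kp] := ltnP p k.
  have h : (p.-1 < k.-1)%N by lia.
  by exists (Ngrk m (Ordinal h)) => /=; lia.
have [pk|kp'] := leqP p k; first by exists (Nodd m k) => /=; lia.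
have h : (p - k.+1 < l)%N by lia.
by exists (Nlat k (Ordinal h)) => /=; lia.
Qed.

(** For m even eps_l and - eps_l are not joined by a simple root, so position r continues to r.+2
    instead of r.+1. *)
Lemma edge_out a : (pos a < M)%N -> exists c a' s s', edge c a a' s s' /\
  (pos a' = (pos a).+1 \/ [/\ ~~ odd m, pos a = r & pos a' = r.+2]).
Proof.
move=> aM; have a0 := pos_gt0 a.
have [ar|ra] := ltnP (pos a) r.
  have [|c cE] := @nd_surj (pos a); first by lia.
  have aE : a = hi c by apply: pos_inj; rewrite pos_hi /hi_pos ifF //; lia.
  exists c, (lo c); do 2 eexists; split; first by rewrite aE; exact: edge_hi_lo.
  by left; rewrite pos_lo cE.
have [[om ar]|H] : odd m /\ pos a = r \/ (odd m ==> (r < pos a)%N).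
  by case: (odd m) => //=; case: ltngtP ra; auto.
  have [|c cE] := @nd_surj (pos a); first by lia.
  have aE : a = hi c by apply: pos_inj; rewrite pos_hi /hi_pos om andbF.
  exists c, (lo c); do 2 eexists; split; first by rewrite aE; exact: edge_hi_lo.
  by left; rewrite pos_lo cE.
have [|c cE] := @nd_surj (M - pos a); first by move: H; case: (boolP (odd m)) => /=; lia.
have aE : a = br (lo c) by apply: pos_inj; rewrite pos_br pos_lo cE; lia.
exists c, (br (hi c)); do 2 eexists; split; first by rewrite aE; exact: edge_br_lo_hi.
rewrite pos_br pos_hi /hi_pos cE; case: ifP => C; [right | left; lia].
by case/andP: C => /eqP C om; split=> //; lia.
Qed.

Lemma edge_in (b : I) : (1 < pos b)%N -> exists c b' s s', edge c b' b s s' /\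
  (pos b = (pos b').+1 \/ [/\ ~~ odd m, pos b' = r.-1 & pos b = r.+1]).
Proof.
move=> b1; have bM := pos_leM b.
have [br1|rb] := leqP (pos b) r.+1.
  have [|c cE] := @nd_surj (pos b).-1; first by lia.
  have bE : b = lo c by apply: pos_inj; rewrite pos_lo cE; lia.
  exists c, (hi c); do 2 eexists; split; first by rewrite bE; exact: edge_hi_lo.
  rewrite pos_hi /hi_pos cE; case: ifP => C; [right | left; lia].
  by case/andP: C => /eqP C om; split => //; lia.
have [|c cE] := @nd_surj (M.+1 - pos b); first by lia.
have cr : ((nd c == r) && ~~ odd m) = false.
  by rewrite cE; case: (boolP (odd m)) => om; rewrite ?andbF // andbT; lia.
have bE : b = br (hi c) by apply: pos_inj; rewrite pos_br pos_hi /hi_pos cr cE; lia.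
exists c, (br (lo c)); do 2 eexists; split; first by rewrite bE; exact: edge_br_lo_hi.
by left; rewrite bE !pos_br pos_lo pos_hi /hi_pos cr cE; lia.
Qed.

(** * The diagonal entries of R *)

Lemma qpMn (s : F) N : qp (s *+ N) = qp s ^+ N.
Proof.
elim: N => [|N IH]; first by rewrite mulr0n qp0 expr0.
by rewrite mulrS qpD IH exprS.
Qed.

(** Raising to the denominator gives an integral power of q equal to 1, so the numerator is zero. *)
Lemma qp_ratr_inj (s : rat) : qp (ratr s) = 1 -> s = 0.
Proof.
move=> s1.
have H N : qp (N%:R) = 1 -> N = 0%N.
  rewrite qpMn qp1 => qN; apply/eqP; rewrite eqn0Ngt; apply/negP => N0.
  by have := q_aper N0; rewrite qN eqxx.
have H1 : qp ((numq s)%:~R) = 1.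
  have -> : (numq s)%:~R = ratr s *+ `|denq s|%N :> F.
    rewrite -[in ratr s](divq_num_den s) rmorphM /= fmorphV /= !ratr_int.
    rewrite -mulr_natr -[X in _ * X]/(Posz `|denq s|%N)%:~R absz_denq divfK //.
    by rewrite intr_eq0 denq_neq0.
  by rewrite qpMn s1 expr1n.
apply/eqP; rewrite -numq_eq0; case: (numq s) H1 => n; first by move=> /H ->.
rewrite NegzE mulrNz qpN => /(congr1 GRing.inv); rewrite invrK invr1 => /H.
by [].
Qed.

Lemma vec_f_lower c x y : act_ef false c x y != 0 -> (pos y < pos x)%N.
Proof. exact: vec_f_lowers. Qed.

Lemma Rent_upper0 (b1 b2 a1 a2 : I) : (pos b1 < pos a1)%N -> Rent b1 b2 a1 a2 = 0.
Proof. by move=> lt; apply/eqP; apply: contraTT lt => /R_tri[]; rewrite -leqNgt. Qed.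

Lemma halfq_sqr c x : halfq c x * halfq c x = qp (wform (alpha c) (wt x)).
Proof. by rewrite /halfq -qpD; congr qp; field. Qed.

Lemma halfq_neq0 c x : halfq c x != 0.
Proof. exact: qp_neq0. Qed.

(** Compare the coefficients of |d e'> after applying R and f_c to |d e>; the terms in which f_c
    moves d vanish by triangularity. *)
Lemma Rent_diag_step c (d e e' : I) s s' : edge c e e' s s' ->
  Rent d e' d e' * qp (wform (alpha c) (wt d)) = Rent d e d e.
Proof.
move=> eE; have [ss Ec Er] := edge_step eE.
have := intertwine false c d e' d e.
rewrite (sum_pick (z0 := e')); last by move=> z ze; rewrite Ec (negPf ze) !mulr0.
rewrite [X in _ + X](sum_pick (z0 := d)); last first.
  move=> z zd; have [->|/vec_f_lower] := eqVneq (act_ef false c z d) 0;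
    first by rewrite !(mul0r, mulr0).
  by move=> lt; rewrite Rent_upper0 ?mul0r.
rewrite [X in _ = X + _](sum_pick (z0 := d)); last first.
  move=> z zd; have [->|/vec_f_lower] := eqVneq (act_ef false c d z) 0;
    first by rewrite !(mul0r, mulr0).
  by move=> lt; rewrite Rent_upper0 ?mulr0.
rewrite [X in _ = _ + X](sum_pick (z0 := e));
  last by move=> z ze; rewrite Er (negPf ze) !(mul0r, mulr0).
have -> : act_ef false c d d = 0.
  by apply/eqP; apply: contraT => /vec_f_lower; rewrite ltnn.
rewrite Ec !eqxx !mulr1 !(mul0r, mulr0) addr0 add0r -halfq_sqr.
set K := halfq c d; set sgn := (-1) ^+ _ => E.
have K0 : K != 0 by exact: halfq_neq0.
have s0 : s != 0.
  by apply: contraTneq isT => s0; move: ss; rewrite s0 mul0r => /esym/eqP; rewrite oner_eq0.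
have N : sgn * s / K != 0 by rewrite !mulf_neq0 ?invr_eq0 // signr_eq0.
by apply: (mulfI N); rewrite -E; field.
Qed.

Lemma wform_wt_int x y : exists n : int, wform (wt x) (wt y) = n%:~R.
Proof.
rewrite wform_wt; exists ((-1) ^+ par x * ((x == y)%:Z - (x == br y)%:Z)).
by rewrite intrM intrB; congr (_ * _); case: (par x).
Qed.

Lemma Rent_cartan (a b : I) : Rent a b a b = qp (wform (wt a) (wt b)).
Proof.
case: R_cartan => t tP.
have R_t (x y : I) : Rent x y x y = qp ((wt x *m map_mx ratr t *m (wt y)^T) 0 0).
  rewrite /Rent (tP V V vec_is_module vec_is_module _ _ vec_weights vec_weights) //.
  by rewrite !eqxx mul1r.
pose T (x y : I) := (wt x *m map_mx ratr t *m (wt y)^T) 0 0.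
(* The weights have integral coordinates and t is rational, so the same expression over [rat] is a
   witness. *)
have T_rat x y : exists s : rat, T x y = ratr s.
  exists ((eps rat m k (label x) *m t *m (eps rat m k (label y))^T) 0 0).
  have E z : wt z = map_mx ratr (eps rat m k (label z)).
    rewrite /wt; case: (label z) => i; rewrite /= map_row_mx map_mx0; congr row_mx;
    by apply/rowP => j; rewrite !mxE rmorphB /= !ratr_nat.
  by rewrite /T !E map_trmx -!map_mxM mxE.
(* The defect of the exponent: constant along arrows by [Rent_diag_step] and odd under [br]. *)
pose u (y : I) := T a y - wform (wt a) (wt y).
have u_rat y : exists s : rat, u y = ratr s.
  have [s Es] := T_rat a y; have [n En] := wform_wt_int a y.
  by exists (s - n%:~R); rewrite rmorphB /= ratr_int -Es -En.
have u_br y : u (br y) = - u y.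
  rewrite /u /T wt_br wformNr linearN /= mulmxN.
  by move: (wt a *m _ *m _) => A; rewrite mxE; ring.
have u_edge c e e' s s' : edge c e e' s s' -> u e' = u e.
  move=> eE; have := Rent_diag_step a eE; rewrite !R_t -/(T a e) -/(T a e') -qpD => E.
  have [s1 E1] := u_rat e; have [s2 E2] := u_rat e'.
  have : qp (ratr (s2 - s1)) = 1.
    rewrite rmorphB /= -E1 -E2.
    have -> : u e' - u e = T a e' + wform (alpha c) (wt a) - T a e.
      by rewrite (edge_wt eE) wformBl /u ![wform (wt a) _]wformC; ring.
    by rewrite qpD E qpN divff // qp_neq0.
  by move/qp_ratr_inj/eqP; rewrite subr_eq0 E1 E2 => /eqP ->.
have u_const y : u y = u (at_pos 1).
  have [n] := ubnP (pos y); elim: n y => // n IH y yn.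
  have [y1|y1] := leqP (pos y) 1.
    congr u; apply: pos_inj; rewrite at_posK; have := pos_gt0 y; lia.
  have [c [y' [s [s' [eE _]]]]] := edge_in y1.
  by rewrite (u_edge _ _ _ _ _ eE) IH //; have := edge_pos eE; lia.
have : u b = 0.
  have := u_br (at_pos 1); rewrite !u_const => /eqP.
  by rewrite -subr_eq0 opprK -mulr2n mulrn_eq0 /= => /eqP.
by rewrite R_t -/(T a b) => /eqP; rewrite subr_eq0 => /eqP ->.
Qed.

(** * The half-sum rho on the simple roots *)

Lemma rho_at_pos p : (0 < p <= r)%N -> wform rho (wt (at_pos p)) =
  2%:R^-1 * (if (p <= k)%N then m%:R + (2 * p)%:R - 2%:R - (k.*2)%:R
             else m%:R - (2 * (p - k))%:R).
Proof.
move=> pr; rewrite /Defs.rho wformZl; congr (_ * _).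
rewrite -[wt _]/(eps F m k (label (at_pos p))) label_at_pos //; last by lia.
rewrite /Defs.wform; case: leqP => pk.
  rewrite [X in X - _]big1 ?sub0r => [|i _]; last by rewrite row_mxEl /= row_mxEl !mxE mulr0.
  under eq_bigr do rewrite row_mxEr /= row_mxEr !mxE mulrBr.
  rewrite sumrB (sum_natr_delta _ _ (fun i => k.*2%:R - m%:R + 2 - (2 * i.+1)%:R)).
  rewrite (sum_natr_delta _ _ (fun i => k.*2%:R - m%:R + 2 - (2 * i.+1)%:R)).
  rewrite ifT ?ifF; try lia.
  by rewrite prednK; [ring | lia].
rewrite (_ : (p <= k + m)%N = true); last by lia.
rewrite [X in _ - X]big1 ?subr0 => [|i _]; last by rewrite row_mxEr /= row_mxEr !mxE mulr0.
under eq_bigr do rewrite row_mxEl /= row_mxEl !mxE mulrBr.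
rewrite sumrB (sum_natr_delta _ _ (fun i => m%:R - (2 * i.+1)%:R)).
rewrite (sum_natr_delta _ _ (fun i => m%:R - (2 * i.+1)%:R)).
rewrite ifT ?ifF; try lia.
by rewrite prednK; [rewrite subr0 | lia].
Qed.

Lemma half_m : (l.*2)%:R = m%:R - (odd m)%:R :> F.
Proof.
have /(congr1 (fun i => i%:R : F)) := odd_double_half m.
by rewrite natrD => E; rewrite -[m%:R]E; ring.
Qed.

(** Position r.+1 is its own mirror if m is odd and the mirror of r if m is even; this treats both
    shapes of the last root together. *)
Lemma wt_at_pos_succ_r : wt (at_pos r.+1) = - wt (at_pos r) *+ (~~ odd m).
Proof.
have [om|om] := boolP (odd m); rewrite ?mulr0n ?mulr1n.
  have br_mid : br (at_pos r.+1) = at_pos r.+1.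
    by apply: pos_inj; rewrite pos_br !at_posK; lia.
  have := wt_br (at_pos r.+1); rewrite br_mid => /eqP.
  by rewrite -subr_eq0 opprK -mulr2n -scaler_nat scaler_eq0 pnatr_eq0 => /eqP.
by rewrite -wt_br; congr wt; apply: pos_inj; rewrite pos_br !at_posK; lia.
Qed.

Lemma rho_at_r : ~~ odd m -> wform rho (wt (at_pos r)) = 0.
Proof.
move=> om; rewrite rho_at_pos ?ifF; try lia.
by rewrite addKn mul2n half_m (negPf om) subr0 subrr mulr0.
Qed.

(** The characteristic property of rho, checked separately inside the odd block, at the odd node,
    inside the even block and at the last node. *)
Lemma wform_rho_alpha c : wform rho (alpha c) = 2%:R^-1 * wform (alpha c) (alpha c).
Proof.
have c0 := nd_range c; rewrite wform_alpha_self // /isg alphaE wformBr /hi /lo /hi_pos.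
case: (eqVneq (nd c) r) => [cr|ncr] /=; last first.
  rewrite !rho_at_pos; try lia.
  case: (leqP (nd c) k) => ck; case: (leqP (nd c).+1 k) => ck'; try lia.
  - by rewrite mulnS natrD; field.
  - have -> : nd c = k by lia.
    by rewrite subSnn -mul2n !natrM; field.
  - rewrite subSn; last by lia.
    by rewrite mulnS natrD; field.
rewrite cr wt_at_pos_succ_r; have [om|om] /= := boolP (odd m).
  rewrite mulr0n wform0r subr0 rho_at_pos ?ifF; try lia.
  by rewrite addKn mul2n half_m om mulr1n; field.
rewrite mulr1n wformNr opprK rho_at_r // addr0 rho_at_pos ?ifF; try lia.
have -> : (2 * (r.-1 - k))%N = (l.*2 - 2)%N by lia.
rewrite natrB; last by lia.
by rewrite half_m (negPf om) mulr0n; field.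
Qed.

(** * The entries |a b> -> |b a> *)

Lemma wform_wt_ortho (a b : I) : a != b -> b != br a -> wform (wt a) (wt b) = 0.
Proof. by move=> /negPf ab ba; rewrite wform_wt ab -br_eq eq_sym (negPf ba) subrr mulr0. Qed.

Lemma wform_wt_self a : a != br a -> wform (wt a) (wt a) = (-1) ^+ par a.
Proof. by move=> /negPf aa; rewrite wform_wt eqxx aa subr0 mulr1. Qed.

Lemma Rent_ortho (a b : I) : a != b -> b != br a -> Rent a b a b = 1.
Proof. by move=> ab ba; rewrite Rent_cartan wform_wt_ortho // qp0. Qed.

Lemma qp_sign (b : bool) :
  qp ((-1) ^+ b) - (qp ((-1) ^+ b))^-1 = (-1) ^+ b * (q - q^-1).
Proof.
case: b; rewrite ?expr0 ?expr1 ?qpN qp1 ?mul1r //.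
by rewrite invrK mulN1r opprB.
Qed.

Lemma halfq_sqr_hi c (a b : I) s s' : edge c a b s s' -> a != br a ->
  halfq c a * halfq c a = qp ((-1) ^+ par a).
Proof.
move=> ab aa; rewrite halfq_sqr (edge_wt ab) wformBl wform_wt_self // wformC.
rewrite wform_wt_ortho ?subr0 ?(edge_br ab) //.
by apply: contraTneq (edge_pos ab) => ->; rewrite ltnn.
Qed.

Lemma halfq_sqr_lo c (a b : I) s s' : edge c a b s s' -> b != br b ->
  halfq c b * halfq c b = (qp ((-1) ^+ par b))^-1.
Proof.
move=> ab bb; rewrite halfq_sqr (edge_wt ab) wformBl wform_wt_self //.
rewrite wform_wt_ortho ?sub0r ?qpN ?(edge_br ab) //.
by apply: contraTneq (edge_pos ab) => ->; rewrite ltnn.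
Qed.

Lemma edge_neq c (a b : I) s s' : edge c a b s s' -> a != b.
Proof. by move=> ab; apply: contraTneq (edge_pos ab) => ->; rewrite ltnn. Qed.

Lemma step_neq0 up c (a b : I) s : step up c a b s -> s != 0.
Proof. by case=> ss _ _; apply/eqP => s0; move/eqP: ss; rewrite s0 mul0r eq_sym oner_eq0. Qed.

Lemma mul_sign_eq (x y : F) (b : bool) : x * (-1) ^+ b = y -> x = (-1) ^+ b * y.
Proof. by move=> <-; rewrite mulrC -mulrA -expr2 sqrr_sign mulr1. Qed.

(** From f_c applied to |a a>: the coefficient of |b a> involves the swap entry and the known
    diagonal entries at |a a> and |b a>, and is solved for the former. *)
Lemma swap_edge_hi c (a b : I) s s' : edge c a b s s' -> a != br a ->
  Rent b a a b = (-1) ^+ (par a && par b) * (q - q^-1).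
Proof.
move=> ab aa; have ne := edge_neq ab; have nb := edge_br ab.
have [_ Ec Er] := edge_step ab; have s0 := step_neq0 (edge_step ab).
have := intertwine false c b a a a.
rewrite (sum_pick (z0 := b)); last by move=> z /negPf zb; rewrite Ec zb !mulr0.
rewrite [X in _ + X](sum_pick (z0 := b)); last first.
  by move=> z /negPf zb; rewrite Ec zb mulr0 mul0r mulr0.
rewrite [X in _ = X + _](sum_pick (z0 := a)); last first.
  by move=> z /negPf zb; rewrite Er zb mulr0 !mul0r.
rewrite [X in _ = _ + X]big1; last first.
  move=> z _; rewrite R_cons0 ?mulr0 //; first by case=> E; rewrite E eqxx in ne.
    by case=> E; rewrite E eqxx in ne.
  by case=> E; rewrite -E eqxx in aa.
rewrite Ec eqxx mulr1 addr0 (Rent_ortho (a := b)); last 2 first.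
- by rewrite eq_sym.
- by rewrite -br_eq eq_sym.
rewrite Rent_cartan wform_wt_self // -(halfq_sqr_hi ab aa).
have K0 := halfq_neq0 c a; move: (halfq_sqr_hi ab aa) K0; set K := halfq c a => KK K0 E.
have {E} : Rent b a a b * (-1) ^+ ((par b (+) par a) && par a) = K * K - (K * K)^-1.
  have N : K * s != 0 by rewrite mulf_neq0.
  apply: (mulfI N); transitivity (s * K * (K * K) - 1 * (s / K)); last by field.
  by rewrite -E; ring.
rewrite KK qp_sign => /mul_sign_eq ->.
by case: (par a); case: (par b) => /=; ring.
Qed.

(** The counterpart from e_c applied to |b b>, which also covers a being the middle label. *)
Lemma swap_edge_lo c (a b : I) s s' : edge c a b s s' -> b != br b ->
  Rent b a a b = (-1) ^+ (par a && par b) * (q - q^-1).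
Proof.
move=> ab bb; have ne := edge_neq ab; have nb := edge_br ab.
have [t tE] := edge_up ab.
have [_ Ec Er] := tE; have s0 := step_neq0 tE.
have := intertwine true c b a b b.
rewrite (sum_pick (z0 := a)); last by move=> z /negPf zb; rewrite Ec zb !mulr0.
rewrite [X in _ + X](sum_pick (z0 := a)); last first.
  by move=> z /negPf zb; rewrite Ec zb mulr0 mul0r mulr0.
rewrite [X in _ = X + _]big1; last first.
  move=> z _; rewrite R_cons0 ?mulr0 //; first by case=> _ E; rewrite E eqxx in ne.
    by case=> _ E; rewrite E eqxx in ne.
  by case=> E; rewrite -E eqxx in bb.
rewrite [X in _ = _ + X](sum_pick (z0 := b)); last first.
  by move=> z /negPf zb; rewrite Er zb mulr0 mulr0 !mul0r.
rewrite Ec !eqxx !mulr1 add0r (Rent_ortho (a := b)); last 2 first.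
- by rewrite eq_sym.
- by rewrite -br_eq eq_sym.
rewrite Rent_cartan wform_wt_self //.
have K0 := halfq_neq0 c b; move: (halfq_sqr_lo ab bb) K0; set K := halfq c b => KK K0 E.
have {E} : Rent b a a b = (-1) ^+ ((par a (+) par b) && par b) * (qp ((-1) ^+ par b) - K * K).
  have N : t / K != 0 by rewrite mulf_neq0 ?invr_eq0.
  apply: (mulfI N); transitivity ((-1) ^+ ((par a (+) par b) && par b) * t / K * qp ((-1) ^+ par b)
    - 1 * ((-1) ^+ ((par a (+) par b) && par b) * K * t)); last by field.
  by rewrite -E; ring.
rewrite KK qp_sign => ->.
by case: (par a); case: (par b) => /=; ring.
Qed.

(** From f_c applied to |a b>, at the coefficient of |b a'>; the inequalities exclude all other
    entries by [R_cons0]. *)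
Lemma swap_move_hi c (a a' b : I) s s' : edge c a a' s s' ->
  b != a -> b != a' -> b != br a -> b != br a' ->
  Rent b a' a' b = (-1) ^+ ((par a (+) par a') && par b) * Rent b a a b.
Proof.
move=> aa' n1 n2 n3 n4; have ne := edge_neq aa'; have nb := edge_br aa'.
have [_ Ec Er] := edge_step aa'; have s0 := step_neq0 (edge_step aa').
have := intertwine false c b a' a b.
rewrite [X in X + _]big1; last first.
  move=> z _; rewrite R_cons0 ?mul0r //.
  - by case=> E; rewrite E eqxx in n1.
  - by case=> _ E; rewrite E eqxx in ne.
  - by case=> _ E; rewrite E br_inv eqxx in n4.
rewrite [X in _ + X](sum_pick (z0 := a')); last first.
  by move=> z /negPf zb; rewrite Ec zb mulr0 mul0r mulr0.
rewrite [X in _ = X + _]big1; last first.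
  move=> z _; rewrite R_cons0 ?mulr0 //.
  - by case=> _ E; rewrite E eqxx in n2.
  - by case=> _ E; rewrite E eqxx in ne.
  - by case=> E; rewrite E eqxx in n3.
rewrite [X in _ = _ + X](sum_pick (z0 := a)); last first.
  by move=> z /negPf zb; rewrite Er zb mulr0 mulr0 !mul0r.
rewrite Ec !eqxx !mulr1 !add0r; have K0 := halfq_neq0 c b; move: K0.
set K := halfq c b => K0 E.
have N : s / K != 0 by rewrite mulf_neq0 ?invr_eq0.
apply: (mulIf N); rewrite E [par a (+) _]addbC; ring.
Qed.

Lemma swap_move_lo c (a b b' : I) s s' : edge c b b' s s' ->
  a != b -> a != b' -> a != br b -> a != br b' ->
  Rent b' a a b' = (-1) ^+ ((par b (+) par b') && par a) * Rent b a a b.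
Proof.
move=> bb' n1 n2 n3 n4; have ne := edge_neq bb'; have nb := edge_br bb'.
have [_ Ec Er] := edge_step bb'; have s0 := step_neq0 (edge_step bb').
have := intertwine false c b' a a b.
rewrite (sum_pick (z0 := b')); last by move=> z /negPf zb; rewrite Ec zb !mulr0.
rewrite [X in _ + X]big1; last first.
  move=> z _; rewrite R_cons0 ?mul0r //.
  - by case=> _ E; rewrite E eqxx in n1.
  - by case=> E; rewrite E eqxx in ne.
  - by case=> _ E; rewrite E eqxx in n4.
rewrite [X in _ = X + _](sum_pick (z0 := b)); last first.
  by move=> z /negPf zb; rewrite Er zb mulr0 !mul0r.
rewrite [X in _ = _ + X]big1; last first.
  move=> z _; rewrite R_cons0 ?mulr0 //.
  - by case=> E; rewrite E eqxx in n2.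
  - by case=> E; rewrite E eqxx in ne.
  - by case=> E; rewrite -br_eq -E eqxx in n3.
rewrite Ec !eqxx !mulr1 !addr0; have K0 := halfq_neq0 c a; move: K0.
set K := halfq c a => K0 E.
have N : s * K != 0 by rewrite mulf_neq0.
apply: (mulIf N); transitivity ((-1) ^+ ((par b (+) par b') && par a) *
  (Rent b' a a b' * ((-1) ^+ ((par b' (+) par b) && par a) * K * s))); last by rewrite E; ring.
by case: (par b); case: (par b'); case: (par a) => /=; ring.
Qed.

(** Induction on the distance. If b comes before [br a] it is moved up, otherwise a is moved down,
    so that b never meets the mirror of a. *)
Lemma Rent_swap (a b : I) : (pos a < pos b)%N -> b != br a ->
  Rent b a a b = (-1) ^+ (par a && par b) * (q - q^-1).
Proof.
have [n] := ubnP (pos b - pos a); elim: n a b => // n IH a b ln ab ba.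
have := pos_leM a; have := pos_gt0 a; have := pos_leM b; have := pos_gt0 b => b0 bM a0 aM.
have nab : a != b by rewrite pos_eq; lia.
have pbr : pos b != (M.+1 - pos a)%N by rewrite -pos_br -pos_eq.
have [lt|gt] := ltnP (pos b) (M.+1 - pos a).
  have [|c [b1 [s [s' [eE pb]]]]] := @edge_in b; first by lia.
  have lt1 := edge_pos eE.
  have [E|ab1] := eqVneq a b1.
    by rewrite E in ln ab ba nab pbr lt a0 aM *;
      apply: (swap_edge_hi eE); rewrite pos_eq pos_br; lia.
  have lt2 : (pos a < pos b1)%N.
    (* If the arrow skips position r, then a cannot sit there, since b at r.+1 would be its
       mirror. *)
    move: ab1; rewrite pos_eq; case: pb => [|[om pb1 pb]]; first by lia.
    have := odd_double_half m; rewrite (negPf om); lia.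
  rewrite (swap_move_lo eE) ?IH //; rewrite ?pos_eq ?pos_br; try lia.
  by case: (par a); case: (par b); case: (par b1) => /=; ring.
have [|c [a1 [s [s' [eE pa]]]]] := @edge_out a; first by lia.
have lt1 := edge_pos eE.
have [E|a1b] := eqVneq a1 b.
  by rewrite E in eE; apply: (swap_edge_lo eE); rewrite pos_eq pos_br; lia.
have lt2 : (pos a1 < pos b)%N.
  move: a1b; rewrite pos_eq; case: pa => [|[om pa1 pa]]; first by lia.
  have := odd_double_half m; rewrite (negPf om); lia.
have b1 : b != br a1 by rewrite pos_eq pos_br; lia.
have ln1 : (pos b - pos a1 < n)%N by lia.
have nba : b != a by rewrite eq_sym.
have nba1 : b != a1 by rewrite eq_sym.
have := swap_move_hi eE nba nba1 ba b1; rewrite (IH a1 b ln1 lt2 b1) => /esym.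
rewrite mulrC => /mul_sign_eq ->.
by case: (par a); case: (par b); case: (par a1) => /=; ring.
Qed.

(** * The recurrence for pairs of mirror labels *)

(* The entries |a abar> -> |b bbar>; for a > b, the sum of
   [cap_formula] and, if b = abar, of the swap entry. *)
Definition cap (a b : I) : F := Rent b (br b) a (br a).

Definition cap_formula (a b : I) : F :=
  - (q - q^-1) * (-1) ^+ par a * sg a * sg b * qp (wform rho (wt b - wt a)).

Lemma halfq_br c x : halfq c (br x) = (halfq c x)^-1.
Proof. by rewrite /halfq wt_br wformNr mulrN qpN. Qed.

(** The powers of q match because q^(rho, alpha_c) is the quotient of [halfq c a] by [halfq c a'],
    as (rho, alpha_c) = (alpha_c, alpha_c)/2; the signs match by [edge_sign]. *)
Lemma cap_formula_step c (a a' b : I) s s' : edge c a a' s s' ->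
  cap_formula a b * ((-1) ^+ ((par a (+) par a') && par a) * halfq c a * s')
  + cap_formula a' b * (s * halfq c a') = 0.
Proof.
move=> aa'; have E : qp (wform rho (wt b - wt a)) * halfq c a
    = qp (wform rho (wt b - wt a')) * halfq c a'.
  have -> : wt b - wt a = (wt b - wt a') - alpha c.
    by rewrite (edge_wt aa') opprB addrA subrK.
  rewrite qp_wformB wform_rho_alpha -mulrA; congr (_ * _).
  have K0 := halfq_neq0 c a'; rewrite {2}(edge_wt aa') wformBr mulrBr qpD qpN.
  rewrite -!/(halfq _ _) invfM invrK mulrAC mulVf ?mul1r //; exact: halfq_neq0.
have S := edge_sign aa'.
rewrite /cap_formula; transitivity (- (q - q^-1) * sg b * (
   (qp (wform rho (wt b - wt a)) * halfq c a) *
     (s' * (-1) ^+ ((par a (+) par a') && par a) * (-1) ^+ par a * sg a)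
   + qp (wform rho (wt b - wt a')) * halfq c a' * (s * (-1) ^+ par a' * sg a'))); first by ring.
by rewrite E S; ring.
Qed.

(** From |a abar'>, f_c reaches |a abar> and |a' abar'>, which gives the two unknowns. R acts on |a
    abar'> itself only diagonally or by a swap, so the right side is nonzero for few b. *)
Lemma cap_intertwine c (a a' b : I) s s' : edge c a a' s s' -> b != a ->
  cap a b * ((-1) ^+ ((par a (+) par a') && par a) * halfq c a * s')
  + cap a' b * (s * halfq c a') =
  (b == a')%:R * (s / halfq c a')
  + (b == br a)%:R * (s' * halfq c a) * Rent (br a') a a (br a')
  + (b == br a')%:R * ((-1) ^+ ((par a (+) par a') && par a') * s * halfq c a')
     * Rent (br a') a a (br a').
Proof.
move=> aa' ba; have ne := edge_neq aa'; have nb := edge_br aa'.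
have [_ Ec Er] := edge_step aa'; have [_ Ec' Er'] := edge_step_br aa'.
have := intertwine false c b (br b) a (br a').
rewrite (sum_pick (z0 := br a)); last by move=> z /negPf zb; rewrite Ec' zb !mulr0.
rewrite [X in _ + X](sum_pick (z0 := a')); last first.
  by move=> z /negPf zb; rewrite Ec zb mulr0 mul0r mulr0.
rewrite Ec Ec' !eqxx !mulr1 halfq_br invrK !par_br => E.
have S1 : \sum_z act_ef false c b z * halfq c (br b) * Rent z (br b) a (br a')
   = (b == a')%:R * (s / halfq c a')
     + (b == br a)%:R * (s' * halfq c a) * Rent (br a') a a (br a').
  have [->|n1] := eqVneq b a'.
    rewrite (sum_pick (z0 := a)); last by move=> z /negPf zb; rewrite Er zb mulr0 !mul0r.
    rewrite Er eqxx (negPf nb) !mulr1 !mul0r addr0 halfq_br mul1r Rent_ortho ?mulr1 //.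
      by rewrite -br_eq eq_sym.
    by rewrite br_eq br_inv eq_sym.
  have [->|n2] := eqVneq b (br a).
    rewrite br_inv (sum_pick (z0 := br a'));
      last by move=> z /negPf zb; rewrite Er' zb mulr0 !mul0r.
    by rewrite Er' eqxx !mulr1 !mul0r add0r mul1r.
  rewrite !mul0r addr0 big1 // => z _; rewrite R_cons0 ?mulr0 //.
  - by case=> _ /(inv_inj br_inv) E1; rewrite E1 eqxx in n1.
  - by case=> _ E1; rewrite -E1 br_inv eqxx in n2.
  - by case=> /(inv_inj br_inv) E1; rewrite E1 eqxx in ne.
have S2 : \sum_z (-1) ^+ ((par b (+) par z) && par b) * act_ef false c (br b) z
      / halfq c b * Rent b z a (br a')
   = (b == br a')%:R * ((-1) ^+ ((par a (+) par a') && par a') * s * halfq c a')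
     * Rent (br a') a a (br a').
  have [->|n1] := eqVneq b (br a').
    rewrite br_inv (sum_pick (z0 := a)); last by move=> z /negPf zb; rewrite Er zb !(mulr0, mul0r).
    by rewrite Er eqxx !par_br ?halfq_br invrK !mulr1 mul1r [par a' (+) _]addbC.
  rewrite !mul0r big1 // => z _; rewrite R_cons0 ?mulr0 //.
  - by case=> E1; rewrite E1 eqxx in ba.
  - by case=> E1; rewrite E1 eqxx in n1.
  - by case=> /(inv_inj br_inv) E1; rewrite E1 eqxx in ne.
by rewrite -S1 -S2 -E.
Qed.

Lemma cap_diag b : cap b b = qp (- wform (wt b) (wt b)).
Proof. by rewrite /cap Rent_cartan wt_br wformNr. Qed.

(** Induction from the lowest a upwards. [cap_formula] solves the homogeneous recurrence, so only
    the terms at b = a', br a', br a have to be balanced. *)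
Lemma Rent_cap (a b : I) : (pos a < pos b)%N ->
  cap a b = cap_formula a b + (b == br a)%:R * ((-1) ^+ par a * (q - q^-1)).
Proof.
have [n] := ubnP (M - pos a); elim: n a => // n IH a ln ab.
have := pos_leM a; have := pos_gt0 a; have := pos_leM b; have := pos_gt0 b => b0 bM a0 aM.
have [|c [a' [s [s' [eE pa]]]]] := @edge_out a; first by lia.
have ba : b != a by rewrite pos_eq; lia.
have s0 := step_neq0 (edge_step eE); have s0' := step_neq0 (edge_step_br eE).
have K0 := halfq_neq0 c a; have K0' := halfq_neq0 c a'.
have N : (-1) ^+ ((par a (+) par a') && par a) * halfq c a * s' != 0.
  by rewrite !mulf_neq0 // signr_eq0.
have aa' := edge_pos eE; have ne := edge_neq eE; have nb := edge_br eE.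
have E := cap_intertwine eE ba; have G0 := cap_formula_step b eE.
apply: (mulIf N).
move: N E G0; set t := (-1) ^+ ((par a (+) par a') && par a).
set K := halfq c a; set K' := halfq c a' => N E G0.
have {}G0 : cap_formula a b * (t * K * s') = - (cap_formula a' b * (s * K')).
  by apply/eqP; rewrite -subr_eq0 opprK G0.
have {}E : cap a b * (t * K * s') = (b == a')%:R * (s / K')
  + (b == br a)%:R * (s' * K) * Rent (br a') a a (br a')
  + (b == br a')%:R * ((-1) ^+ ((par a (+) par a') && par a') * s * K')
     * Rent (br a') a a (br a') - cap a' b * (s * K') by rewrite -E addrK.
(* The arrow passes below b only if m is even, a is at r and b = br a. The entry is then zero, and
   [cap_formula] cancels the swap term because (rho, eps_l) = 0. *)
have [lt|le] := ltnP (pos b) (pos a').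
  case: pa => [|[om ar ar']]; first by clear N E G0; lia.
  have mE := odd_double_half m; rewrite (negPf om) in mE.
  have bE : b = br a by apply: pos_inj; rewrite pos_br ar; clear N E G0; lia.
  have pa0 : par a = false by rewrite parE ar; clear N E G0; lia.
  have aE : a = at_pos r by apply: pos_inj; rewrite ar at_posK //; clear N E G0; lia.
  have X0 : Rent (br a') a a (br a') = 0.
    by rewrite Rent_upper0 // pos_br ar ar'; clear N E G0; lia.
  have C0 : cap a' (br a) = 0 by rewrite /cap Rent_upper0 // -bE.
  rewrite E bE X0 C0 eqxx (_ : br a == a' = false); last by rewrite eq_sym (negPf nb).
  rewrite !(mul0r, mulr0) !(add0r, subr0) mul1r; symmetry.
  rewrite /cap_formula (sg_even pa0) sg_even ?par_br // pa0 expr0 wt_br wformBr wformNr aE.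
  by rewrite (rho_at_r om) !(oppr0, addr0) qp0; ring.
rewrite mulrDl G0 E; clear N E G0; have [bE|nba'] := eqVneq b a'.
  (* Here [cap a' b] is a diagonal entry; it equals 1 if a' is the middle label, in which case a
     swap entry appears as well. *)
  rewrite bE cap_diag (negPf nb).
  have GE : cap_formula a' a' = - ((-1) ^+ par a' * (q - q^-1)).
    rewrite /cap_formula subrr wform0r qp0 -!mulrA mulr1 sgK mulr1; ring.
  rewrite GE; have [mid|nmid] := eqVneq a' (br a').
    have pa'0 : par a' = false by rewrite parE; have := pos_br a'; rewrite -mid; lia.
    have KK : K' * K' = 1.
      by rewrite /K' halfq_sqr (edge_wt eE) wformBl !wform_wt -!mid !(subrr, mulr0) qp0.
    have -> : s / K' = s * K' by apply: (mulIf K0'); rewrite divfK // -mulrA KK mulr1.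
    rewrite -mid Rent_swap ?pa'0 ?andbF ?expr0; try by [].
    by rewrite wform_wt -mid eqxx subrr mulr0 oppr0 qp0 !(mulr1n, mulr0n); ring.
  have w0 : qp ((-1) ^+ par a') != 0 by exact: qp_neq0.
  have KK := halfq_sqr_lo eE nmid; rewrite -/K' in KK.
  have -> : s / K' = qp ((-1) ^+ par a') * s * K'.
    by apply: (mulIf K0'); rewrite divfK // -!mulrA KK mulrCA mulfV ?mulr1.
  by rewrite wform_wt_self // qpN -qp_sign !(mulr1n, mulr0n); ring.
have lt : (pos a' < pos b)%N by move: nba'; rewrite pos_eq; lia.
rewrite IH //; last by lia.
(* For b = br a' the swap term of (a', b) cancels the swap entry on the right; for b = br a that
   entry becomes the swap term of (a, b). *)
have [bE|nb1] := eqVneq b (br a').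
  have -> : (b == br a) = false by rewrite bE (inj_eq (inv_inj br_inv)) eq_sym (negPf ne).
  rewrite -bE Rent_swap //; last by rewrite bE (inj_eq (inv_inj br_inv)) eq_sym.
  by rewrite bE par_br !(mulr1n, mulr0n); case: (par a); case: (par a') => /=; ring.
have [bE|nb2] := eqVneq b (br a); last by rewrite !mulr0n; ring.
rewrite Rent_swap; last 2 first.
- by move: lt; rewrite bE !pos_br; lia.
- by rewrite (inj_eq (inv_inj br_inv)) eq_sym.
by rewrite par_br /t !(mulr1n, mulr0n); case: (par a); case: (par a') => /=; ring.
Qed.

(** * Assembling the formula for R *)

Lemma sigma_tilde_label (a b : I) : sigma_tilde m k qp (label b) (label a) =
  delta_mx b a - ((-1) ^+ (par b && (par a (+) par b)) * sg a * sg b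
     * qp (wform rho (wt a - wt b))) *: delta_mx (br a) (br b).
Proof. by rewrite /sigma_tilde -!label_br !E_label. Qed.

Lemma vec_Rmatrix : Rmat V V =
  \sum_(a <- Iset m k) \sum_(b <- Iset m k)
      qp (wform (eps F m k a) (eps F m k b))
        *: gtens (@vec_par m k) (@vec_par m k) (E F m k a a) (E F m k b b)
  + (q - q^-1) *:
      \sum_(a <- Iset m k) \sum_(b <- Iset m k | eps_gt m k b a)
        (-1) ^+ gr b
          *: gtens (@vec_par m k) (@vec_par m k)
                   (E F m k a b) (sigma_tilde m k qp b a).
Proof.
apply/matrixP=> x y; rewrite -(mxtens_unindexK x) -(mxtens_unindexK y).
case: (mxtens_unindex x) (mxtens_unindex y) => [b1 b2] [a1 a2].
rewrite -/(Rent b1 b2 a1 a2) mxE [X in _ + X]mxE !(@big_Iset _ xpredT) !summxE.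
under eq_bigr do rewrite (@big_Iset _ xpredT) summxE.
(* The matrix units leave only the term (b1, b2) of the first double sum and (b1, a1) of the
   second. *)
rewrite (sum_pick (z0 := b1)); last first.
  move=> z /negPf zb; rewrite big1 // => z' _.
  by rewrite !E_label mxE [X in _ * X]gtensE !mxE eq_sym zb !(mul0r, mulr0).
rewrite (sum_pick (z0 := b2)); last first.
  move=> z /negPf zb.
  by rewrite !E_label mxE [X in _ * X]gtensE !mxE [b2 == z]eq_sym zb !(mul0r, mulr0).
rewrite [X in _ + _ * X](sum_pick (z0 := b1)); last first.
  move=> z /negPf zb; rewrite big_Iset summxE big1 // => z' _.
  by rewrite !E_label mxE [X in _ * X]gtensE !mxE eq_sym zb !(mul0r, mulr0).
rewrite big_Iset summxE big_mkcond [X in _ + _ * X](sum_pick (z0 := a1)); last first.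
  move=> z /negPf zb; case: ifP => // _.
  by rewrite !E_label mxE [X in _ * X]gtensE !mxE [a1 == z]eq_sym zb andbF !(mul0r, mulr0).
rewrite !E_label mxE [X in _ * X + _]gtensE eps_gtE.
rewrite -[eps F m k (label b1)]/(wt b1) -[eps F m k (label b2)]/(wt b2).
rewrite -[gr (label a1)]/(par a1).
(* The entry of the second tensor factor with the sign of the graded tensor product. *)
pose st : F := (-1) ^+ ((par b2 (+) par a2) && par a1) *
  ((b2 == a1)%:R * (a2 == b1)%:R - (-1) ^+ (par a1 && (par b1 (+) par a1)) * sg b1 * sg a1
     * qp (wform rho (wt b1 - wt a1)) * ((b2 == br b1)%:R * (a2 == br a1)%:R)).
have -> : (if (pos a1 < pos b1)%N then ((-1) ^+ par a1 *: gtens (@vec_par m k) (@vec_par m k)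
    (delta_mx b1 a1) (sigma_tilde m k qp (label a1) (label b1)))
     (mxtens_index (b1, b2)) (mxtens_index (a1, a2)) else 0) =
  if (pos a1 < pos b1)%N then (-1) ^+ par a1 * st else 0.
  case: ifP => // _; rewrite mxE [X in _ * X]gtensE sigma_tilde_label !mxE !eqxx.
  by rewrite /st mul1r -!natrM !mulnb.
rewrite !mxE !eqxx !andTb.
have [Eb|nb1] := eqVneq b1 a1.
  rewrite Eb ltnn mulr0 addr0 mulr1n mul1r.
  have [->|nb2] := eqVneq a2 b2; first by rewrite Rent_cartan addbb expr0 mul1r mulr1.
  rewrite !mulr0 R_cons0 //.
  - by case=> _ E; rewrite E eqxx in nb2.
  - by case=> E1 E2; rewrite E2 E1 eqxx in nb2.
  - by case=> E1 E2; rewrite E1 E2 eqxx in nb2.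
rewrite mulr0n mul0r !mulr0 add0r.
case: ltnP => [lt|le]; last first.
  by rewrite Rent_upper0 ?mulr0 // ltn_neqAle le andbT -pos_eq.
(* Mirror pairs come first: if moreover b1 = br a1, the same entry is also a swap, and [Rent_cap]
   contains both terms. *)
rewrite /st; have [/andP[/eqP E1 /eqP E2]|ncap] := boolP ((b2 == br b1) && (a2 == br a1)).
  rewrite E1 E2 -/(cap a1 b1) Rent_cap // /cap_formula !eqxx.
  rewrite br_eq [br a1 == b1]eq_sym !par_br.
  have [->|_] := eqVneq b1 (br a1); rewrite !(mulr1n, mulr0n) ?par_br ?addbb;
    by case: (par a1); case: (par b1) => /=; ring.
have [/andP[/eqP E1 /eqP E2]|nswap] := boolP ((b2 == a1) && (a2 == b1)).
  have ba : b1 != br a1 by apply: contra ncap => /eqP E3; rewrite E1 E2 E3 br_inv !eqxx.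
  rewrite -!natrM !mulnb (negPf ncap) E1 E2 Rent_swap // !eqxx !(mulr1n, mulr0n).
  by case: (par a1); case: (par b1) => /=; ring.
rewrite -!natrM !mulnb (negPf ncap) (negPf nswap) R_cons0.
- by rewrite !mulr0n; ring.
- by case=> E; rewrite E eqxx in nb1.
- by case=> E1 E2; rewrite E1 E2 !eqxx in nswap.
- by case=> E1 E2; rewrite E1 E2 !eqxx in ncap.
Qed.

End VectorRmatrix.

Theorem theorem5p8p1 (R : realType) (m k : nat) (q : R[i]) (qp : R[i] -> R[i])
    (Rmat : family2 R[i] m k) :
  (2 < m)%N -> (0 < k)%N ->
  q != 0 -> (forall N : nat, (0 < N)%N -> q ^+ N != 1) ->
  power_choice q qp ->
  universal_Rmatrix q qp Rmat ->
  in_completed_Uminus_Uplus q qp Rmat ->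
  rational_Cartan_part q qp Rmat ->
  Rmat (vec m k qp) (vec m k qp)
  = \sum_(a <- Iset m k) \sum_(b <- Iset m k)
      qp (wform (eps R[i] m k a) (eps R[i] m k b))
        *: gtens (@vec_par m k) (@vec_par m k) (E R[i] m k a a) (E R[i] m k b b)
    + (q - q^-1) *:
      \sum_(a <- Iset m k) \sum_(b <- Iset m k | eps_gt m k b a)
        (-1) ^+ gr b
          *: gtens (@vec_par m k) (@vec_par m k)
                   (E R[i] m k a b) (sigma_tilde m k qp b a).
Proof.
move=> m_gt2 k_gt0 q_neq0 q_aper qpP R_univ R_comp R_cartan.
exact: (vec_Rmatrix m_gt2 k_gt0 q_neq0 q_aper qpP R_univ R_comp R_cartan).
Qed.
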